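(* Given a finite alphabet $\Sigma$ and a context-free grammar $G$ over terminal alphabet $\Sigma$, deciding whether $L(G)\cap P_\Sigma\neq\emptyset$ is in NP (with input size $|G|+|\Sigma|$).
   Context: For a finite alphabet $\Sigma$, a pangram is a string over $\Sigma$ in which each letter of $\Sigma$ occurs at least once; $P_\Sigma$ is the set of pangrams. $|G|$ is the size of the grammar (total size of its rules). *)

(* Defs.v *)
From Stdlib Require Import BinNums.
From Stdlib Require BinPos BinNat List.
From mathcomp Require Import all_boot.
Set Implicit Arguments. Unset Strict Implicit. Unset Printing Implicit Defensive.

(* Context-free grammars.  The terminal alphabet Sigma of size k is
   identified with {0,...,k-1}; nonterminals are {0,...,nnt-1}.        *)
Inductive symb := T of nat | NT of nat.

Record cfg := CFG {
  nnt   : nat;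
  start : nat;
  rules : seq (nat * seq symb)
}.

Inductive derives (G : cfg) : nat -> seq nat -> Prop :=
| derives_rule A rhs w :
    List.In (A, rhs) (rules G) -> derives_seq G rhs w -> derives G A w
with derives_seq (G : cfg) : seq symb -> seq nat -> Prop :=
| dseq_nil : derives_seq G [::] [::]
| dseq_T a rest w : derives_seq G rest w -> derives_seq G (T a :: rest) (a :: w)
| dseq_NT B rest u v :
    derives G B u -> derives_seq G rest v -> derives_seq G (NT B :: rest) (u ++ v).

Definition in_lang (G : cfg) (w : seq nat) : Prop := derives G (start G) w.

Definition wf_symb (k n : nat) (s : symb) : bool :=
  match s with T a => a < k | NT b => b < n end.
Definition wf_cfg (k : nat) (G : cfg) : Prop :=
  start G < nnt G /\
  forall A rhs, List.In (A, rhs) (rules G) -> A < nnt G /\ all (wf_symb k (nnt G)) rhs.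

Definition pangram (k : nat) (w : seq nat) : Prop :=
  all (fun a => a < k) w /\ forall a, a < k -> a \in w.

Definition cfg_size (G : cfg) : nat :=
  nnt G + sumn (map (fun r => (size r.2).+1) (rules G)).

(* Deterministic single-tape Turing machines with a finite control.
   States: 'I_(nQ+3), 0 = start, 1 = accept, 2 = reject (halting).
   Tape symbols: 'I_(nS+5); 0 = blank, 1,2 = bits, 3 = field separator,
   4 = instance/certificate separator; further symbols are work symbols.
   Move: true = right, false = left.  Bi-infinite tape.                *)
Record TM := MkTM {
  nQ : nat;
  nS : nat;
  delta : 'I_(nQ.+3) -> 'I_(nS.+4.+1) -> 'I_(nQ.+3) * 'I_(nS.+4.+1) * bool
}.

Record tmconf (M : TM) := Conf {
  cstate : 'I_((nQ M).+3);
  cleft  : seq 'I_((nS M).+4.+1);   (* reversed: head of list is the cell just left *)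
  chead  : 'I_((nS M).+4.+1);
  cright : seq 'I_((nS M).+4.+1)
}.

Definition tm_step (M : TM) (c : tmconf M) : tmconf M :=
  let q := cstate c in
  if (val q == 1) || (val q == 2) then c else
  match delta q (chead c) with
  | (q', s', true) =>
      Conf q' (s' :: cleft c) (head ord0 (cright c)) (behead (cright c))
  | (q', s', false) =>
      Conf q' (behead (cleft c)) (head ord0 (cleft c)) (s' :: cright c)
  end.

Definition tm_init (M : TM) (x : seq nat) : tmconf M :=
  let t := map (fun a : nat => (inord a : 'I_((nS M).+4.+1))) x in
  Conf ord0 [::] (head ord0 t) (behead t).

Definition accepts_within (M : TM) (t : nat) (x : seq nat) : Prop :=
  val (cstate (iter t (@tm_step M) (tm_init M x))) = 1.

(* NP (verifier characterisation) for a decision problem on instances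
   of type I, given an encoding enc (a string over the symbols {1,2,3}),
   a size measure sz, the set of admissible instances dom, and the yes
   instances yes: there is a TM M and a polynomial bound c*n^c + c such
   that for every admissible instance i, i is a yes instance iff some
   certificate (bit string) of polynomial length makes M accept
   enc i ++ [4] ++ cert in polynomially many steps.                    *)
Definition poly_bound (c n : nat) : nat := c * n ^ c + c.

Definition enc_cert (b : seq bool) : seq nat := map (fun x => if x then 2 else 1) b.

Definition in_NP (I : Type) (enc : I -> seq nat) (sz : I -> nat)
    (dom : I -> Prop) (yes : I -> Prop) : Prop :=
  exists (M : TM) (c : nat), forall i, dom i ->
    (yes i <->
     exists cert : seq bool, size cert <= poly_bound c (sz i) /\
       accepts_within M (poly_bound c (sz i)) (enc i ++ 4 :: enc_cert cert)).

Fixpoint bits_pos (p : positive) : seq nat :=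
  match p with
  | xI p' => 2 :: bits_pos p'
  | xO p' => 1 :: bits_pos p'
  | xH => [:: 2]
  end.

Definition enc_nat (n : nat) : seq nat :=
  match BinNat.N.of_nat n with N0 => [:: 3] | Npos p => bits_pos p ++ [:: 3] end.

Definition enc_symb (s : symb) : seq nat :=
  match s with T a => 1 :: enc_nat a | NT b => 2 :: enc_nat b end.

Definition enc_rule (r : nat * seq symb) : seq nat :=
  enc_nat r.1 ++ enc_nat (size r.2) ++ flatten (map enc_symb r.2).

Definition enc_inst (i : nat * cfg) : seq nat :=
  let: (k, G) := i in
  enc_nat k ++ enc_nat (nnt G) ++ enc_nat (start G) ++ enc_nat (size (rules G))
    ++ flatten (map enc_rule (rules G)).

Definition inst_size (i : nat * cfg) : nat := cfg_size i.2 + i.1.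

Definition pangram_cfg_yes (i : nat * cfg) : Prop :=
  exists w, in_lang i.2 w /\ pangram i.1 w.

(* Main.v *)
Require Import Defs.
From mathcomp Require Import all_boot.
From Stdlib Require Import BinNums.
From Stdlib Require BinPos BinNat List Pnat Nnat.
From mathcomp Require Import zify.
Set Implicit Arguments. Unset Strict Implicit. Unset Printing Implicit Defensive.

(* A pangram may only have derivation trees of exponential size, so the certificate describes a
   pruned tree.  It first proves nonterminals productive one at a time; as soon as [B] is known to
   be productive the rule [B -> eps] is added to the grammar; inserting words derived from the erased
   nonterminals turns every new word into an old one without losing a letter.  Then it describes a
   leftmost derivation of the extended grammar whose word contains all letters, each step being given
   by the position of its rule in unary.

   Such a derivation of polynomial size exists: keep the subtree spanned by one leaf per letter and
   erase everything else.  It branches fewer than [l] times for [l] letters, and on a path without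
   branching no nonterminal has to be repeated.

   The verifier is written in a structured language over a fixed number of stacks, which is compiled
   to a program with jumps; that program is run by a single-tape machine that keeps stack [i] in
   track [i] of the tape, bottom first, and walks back to the left end after each instruction. *)

(** * A stack language and its Turing machines *)

(** A shortest word of a productive nonterminal may itself be exponentially long
    ([A_i -> A_(i+1) A_(i+1)]), so productivity cannot be shown by exhibiting a word. With erasure
    available, one rule suffices for each new productive nonterminal: the nonterminals on its right
    side are already known to be productive and are erased at once. The order matters for soundness,
    since [B -> eps] is added only after a derivation from [B] in the grammar extended so far.

    The evaluation relation is inductive, so every certificate, also a senseless one, must be shown
    to lead to a terminating evaluation. Unary rule positions give this for free: each expansion
    consumes certificate symbols and adds at most one right side. They also make finding a rule a
    plain walk along the list.

    That all letters occur is checked with the same code: the letters of the derived word are kept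
    as rules [a -> eps], and for each letter of the alphabet the certificate gives the position of
    such a rule. *)

Definition branch (T : Type) (a : nat) (x0 x1 x2 x3 x4 : T) : T :=
  match a with 1 => x1 | 2 => x2 | 3 => x3 | 4 => x4 | _ => x0 end.

Definition nstk := 10.

Definition memory := seq (seq nat).
Definition stk (m : memory) (i : nat) : seq nat := nth [::] m i.
Definition setstk (m : memory) (i : nat) (s : seq nat) : memory := set_nth [::] m i s.

(** The branches of [Pop] are for the empty stack and for the symbols 1 to 4. [Break] leaves the
    innermost loop, [Fail] rejects at once. *)
Inductive cmd :=
| Skip | Break | Fail
| Push of nat & nat
| Seq of cmd & cmd
| Loop of cmd
| Pop of nat & cmd & cmd & cmd & cmd & cmd.

Inductive outcome := Norm of memory | Brk of memory | Abort.

(** The time is exactly the number of instructions executed by the compiled code; [Seq] and [Loop]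
    cost nothing because they only determine jump targets. *)
Inductive ev : cmd -> memory -> outcome -> nat -> Prop :=
| ev_skip m : ev Skip m (Norm m) 1
| ev_break m : ev Break m (Brk m) 1
| ev_fail m : ev Fail m Abort 1
| ev_push i a m : i < nstk -> 0 < a < 5 ->
    ev (Push i a) m (Norm (setstk m i (a :: stk m i))) 1
| ev_seq c d m m1 o t1 t2 : ev c m (Norm m1) t1 -> ev d m1 o t2 ->
    ev (Seq c d) m o (t1 + t2)
| ev_seq_brk c d m m1 t : ev c m (Brk m1) t -> ev (Seq c d) m (Brk m1) t
| ev_seq_abort c d m t : ev c m Abort t -> ev (Seq c d) m Abort t
| ev_loop c m m1 o t1 t2 : ev c m (Norm m1) t1 -> ev (Loop c) m1 o t2 ->
    ev (Loop c) m o (t1 + t2)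
| ev_loop_brk c m m1 t : ev c m (Brk m1) t -> ev (Loop c) m (Norm m1) t
| ev_loop_abort c m t : ev c m Abort t -> ev (Loop c) m Abort t
| ev_pop i c0 c1 c2 c3 c4 m o t : i < nstk ->
    ev (branch (head 0 (stk m i)) c0 c1 c2 c3 c4) (setstk m i (behead (stk m i))) o t ->
    ev (Pop i c0 c1 c2 c3 c4) m o t.+1.

(** * Jump programs and the correctness of compilation *)

Inductive instr :=
| IAcc | IRej
| IJmp of nat
| IPush of nat & nat & nat
| IPop of nat & nat & nat & nat & nat & nat.

Fixpoint clen (c : cmd) : nat :=
  match c with
  | Seq c d => clen c + clen d
  | Loop c => clen c
  | Pop _ c0 c1 c2 c3 c4 => (clen c0 + clen c1 + clen c2 + clen c3 + clen c4).+1
  | _ => 1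
  end.

(* [nx] is the address to continue at, [bk] the target of [Break], and address 1 rejects. *)
Fixpoint comp (c : cmd) (b nx bk : nat) : seq instr :=
  match c with
  | Skip => [:: IJmp nx]
  | Break => [:: IJmp bk]
  | Fail => [:: IJmp 1]
  | Push i a => [:: IPush i a nx]
  | Seq c d => comp c b (b + clen c) bk ++ comp d (b + clen c) nx bk
  | Loop c => comp c b b nx
  | Pop i c0 c1 c2 c3 c4 =>
    let b0 := b.+1 in let b1 := b0 + clen c0 in let b2 := b1 + clen c1 in
    let b3 := b2 + clen c2 in let b4 := b3 + clen c3 in
    IPop i b0 b1 b2 b3 b4 ::
      comp c0 b0 nx bk ++ comp c1 b1 nx bk ++ comp c2 b2 nx bk ++
      comp c3 b3 nx bk ++ comp c4 b4 nx bk
  end.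

Lemma size_comp c b nx bk : size (comp c b nx bk) = clen c.
Proof.
elim: c b nx bk => //= [c IHc d IHd|i c0 H0 c1 H1 c2 H2 c3 H3 c4 H4] b nx bk.
  by rewrite size_cat IHc IHd.
by rewrite !size_cat H0 H1 H2 H3 H4 !addnA.
Qed.

Lemma clen_gt0 c : 0 < clen c.
Proof. by elim: c => //= c IHc d IHd; rewrite addn_gt0 IHc. Qed.

Section Machine.
Variable P : seq instr.

Inductive istep : nat * memory -> nat * memory -> Prop :=
| is_jmp pc m n : nth IRej P pc = IJmp n -> n < size P -> istep (pc, m) (n, m)
| is_push pc m i a n : nth IRej P pc = IPush i a n -> n < size P ->
    i < nstk -> 0 < a < 5 -> istep (pc, m) (n, setstk m i (a :: stk m i))
| is_pop pc m i n0 n1 n2 n3 n4 n : nth IRej P pc = IPop i n0 n1 n2 n3 n4 ->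
    n = branch (head 0 (stk m i)) n0 n1 n2 n3 n4 -> n < size P -> i < nstk ->
    istep (pc, m) (n, setstk m i (behead (stk m i))).

Inductive isteps : nat -> nat * memory -> nat * memory -> Prop :=
| iss0 s : isteps 0 s s
| issS t s1 s2 s3 : istep s1 s2 -> isteps t s2 s3 -> isteps t.+1 s1 s3.

Lemma isteps1 s1 s2 : istep s1 s2 -> isteps 1 s1 s2.
Proof. by move=> H; apply: issS H (iss0 _). Qed.

Lemma isteps_add t1 t2 s1 s2 s3 :
  isteps t1 s1 s2 -> isteps t2 s2 s3 -> isteps (t1 + t2) s1 s3.
Proof. by move=> H; elim: H s3 => // t a b c Hab _ IH s3 /IH; apply: issS. Qed.

Definition code_at (b : nat) (code : seq instr) : Prop :=
  b + size code <= size P /\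
  forall j, j < size code -> nth IRej P (b + j) = nth IRej code j.

Lemma code_at_cat b c1 c2 :
  code_at b (c1 ++ c2) -> code_at b c1 /\ code_at (b + size c1) c2.
Proof.
case=> Hs Hn; rewrite size_cat in Hs Hn; split; split; try lia.
  by move=> j Hj; rewrite Hn ?nth_cat ?Hj //; lia.
move=> j Hj; rewrite -addnA Hn ?nth_cat; last lia.
by rewrite ltnNge leq_addr /= addKn.
Qed.

Definition target (nx bk : nat) (o : outcome) : nat :=
  match o with Norm _ => nx | Brk _ => bk | Abort => 1 end.
Definition omem (o : outcome) (m : memory) : Prop :=
  match o with Norm m' | Brk m' => m' = m | Abort => True end.

Lemma comp_correct c m o t : ev c m o t ->
  forall b nx bk, code_at b (comp c b nx bk) ->
  nx < size P -> bk < size P -> 1 < size P ->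
  exists2 m', omem o m' & isteps t (b, m) (target nx bk o, m').
Proof.
elim=> {c m o t}.
- move=> m b nx bk [_ /(_ 0 isT)]; rewrite addn0 => H *; exists m => //.
  exact/isteps1/is_jmp.
- move=> m b nx bk [_ /(_ 0 isT)]; rewrite addn0 => H *; exists m => //.
  exact/isteps1/is_jmp.
- move=> m b nx bk [_ /(_ 0 isT)]; rewrite addn0 => H *; exists m => //.
  exact/isteps1/is_jmp.
- move=> i a m Hi Ha b nx bk [_ /(_ 0 isT)]; rewrite addn0 => H *.
  by eexists; last by apply/isteps1/is_push; first exact: H.
- move=> c d m m1 o t1 t2 _ IH1 _ IH2 b nx bk /= /code_at_cat [H1 H2] Hn Hb H.
  rewrite size_comp in H2.
  have Hm : b + clen c < size P.
    by case: H2 => + _; rewrite size_comp; have := clen_gt0 d; lia.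
  have [_ /= <- R1] := IH1 _ _ _ H1 Hm Hb H.
  have [m' Hm' R2] := IH2 _ _ _ H2 Hn Hb H.
  by exists m' => //; apply: isteps_add R1 R2.
- move=> c d m m1 t _ IH b nx bk /= /code_at_cat [H1 H2] Hn Hb H.
  rewrite size_comp in H2.
  have Hm : b + clen c < size P.
    by case: H2 => + _; rewrite size_comp; have := clen_gt0 d; lia.
  exact: IH H1 Hm Hb H.
- move=> c d m t _ IH b nx bk /= /code_at_cat [H1 H2] Hn Hb H.
  rewrite size_comp in H2.
  have Hm : b + clen c < size P.
    by case: H2 => + _; rewrite size_comp; have := clen_gt0 d; lia.
  exact: IH H1 Hm Hb H.
- move=> c m m1 o t1 t2 _ IH1 _ IH2 b nx bk /= Hc Hn Hb H.
  have Hm : b < size P.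
    by case: Hc => + _; rewrite size_comp; have := clen_gt0 c; lia.
  have [_ /= <- R1] := IH1 _ _ _ Hc Hm Hn H.
  have [m' Hm' R2] := IH2 b nx bk Hc Hn Hb H.
  by exists m' => //; apply: isteps_add R1 R2.
- move=> c m m1 t _ IH b nx bk /= Hc Hn Hb H.
  have Hm : b < size P.
    by case: Hc => + _; rewrite size_comp; have := clen_gt0 c; lia.
  exact: IH _ _ _ Hc Hm Hn H.
- move=> c m t _ IH b nx bk /= Hc Hn Hb H.
  have Hm : b < size P.
    by case: Hc => + _; rewrite size_comp; have := clen_gt0 c; lia.
  exact: IH _ _ _ Hc Hm Hn H.
- move=> i c0 c1 c2 c3 c4 m o t Hi _ IH b nx bk /= Hc Hn Hb H.
  move: Hc; set b0 := b.+1; set b1 := b0 + _; set b2 := b1 + _.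
  set b3 := b2 + _; set b4 := b3 + _ => Hc.
  rewrite -cat1s in Hc; have [[_ /(_ 0 isT)]] := code_at_cat Hc.
  rewrite addn0 addn1 /= -/b0 => HI.
  case/code_at_cat; rewrite size_comp -/b1 => C0.
  case/code_at_cat; rewrite size_comp -/b2 => C1.
  case/code_at_cat; rewrite size_comp -/b3 => C2.
  case/code_at_cat; rewrite size_comp -/b4 => C3 C4.
  set h := head 0 _ in IH.
  have Hcd : code_at (branch h b0 b1 b2 b3 b4)
      (comp (branch h c0 c1 c2 c3 c4) (branch h b0 b1 b2 b3 b4) nx bk).
    by rewrite /branch; case: (h) => [|[|[|[|[|?]]]]].
  have [m' Hm' R] := IH _ _ _ Hcd Hn Hb H.
  exists m' => //; apply: issS R; apply: is_pop HI _ _ Hi => //.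
  by case: Hcd => + _; rewrite size_comp; have := clen_gt0 (branch h c0 c1 c2 c3 c4); lia.
Qed.

(** * Ten stacks on the tracks of a single tape *)

Definition tracks := {ffun 'I_nstk -> 'I_5}.
(* [None] is the home marker, placed just left of the input. *)
Definition cell := option tracks.
Definition sym := 'I_(5 + #|{: cell}|).

(* A head phase and a program counter; [None] is the state that writes the home marker.
   Phases: (false, false) walks left to the home cell and then executes the current instruction,
   (false, true) and (true, false) look for the top of a stack to push or to pop,
   (true, true) reads and erases the top. *)
Definition ctl := option (bool * bool * 'I_(size P).+1).
Definition qenc (q : ctl) : 'I_(3 + #|{: ctl}|) := rshift 3 (enum_rank q).
Definition senc (g : cell) : sym := rshift 5 (enum_rank g).
(** The five given tape symbols are read as cells with that symbol in track 0 and zeros elsewhere,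
    so the untouched input already is stack 0 and a blank cell is empty in all tracks. *)
Definition sdec (s : sym) : cell :=
  match split s with
  | inl j => Some [ffun i : 'I_nstk => if val i == 0 then j else ord0]
  | inr r => enum_val r
  end.
Definition st (a b : bool) (pc : nat) := qenc (Some (a, b, inord pc)).

Definition upd_track (g : tracks) (i a : nat) : tracks :=
  [ffun l => if val l == i then inord a else g l].

(** A pop walks to the first digit 0 and then steps left onto the top. If that step hits the home
    marker the stack was empty, which is why the last phase also has to react to [None]. *)
Definition tdelta (q : 'I_(3 + #|{: ctl}|)) (s : sym) : 'I_(3 + #|{: ctl}|) * sym * bool :=
  match split q with
  | inl _ => (qenc None, s, false)
  | inr r => match enum_val r with
    | None => (st false false 2, senc None, true)
    | Some (x, y, pc) =>
      let I := nth IRej P pc in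
      match sdec s, x, y with
      | None, false, false =>
        match I with
        | IAcc => (lshift _ (inord 1 : 'I_3), s, true)
        | IRej => (lshift _ (inord 2 : 'I_3), s, true)
        | IJmp n => (st false false n, s, true)
        | IPush _ _ _ => (st false true pc, s, true)
        | IPop _ _ _ _ _ _ => (st true false pc, s, true)
        end
      | Some _, false, false => (q, s, false)
      | Some g, false, true =>
        match I with
        | IPush i a n =>
          if val (g (inord i)) == 0 then (st false false n, senc (Some (upd_track g i a)), false)
          else (q, s, true)
        | _ => (q, s, true)
        end
      | Some g, true, false =>
        match I with
        | IPop i _ _ _ _ _ =>
          if val (g (inord i)) == 0 then (st true true pc, s, false) else (q, s, true)
        | _ => (q, s, true)
        end
      | Some g, true, true =>
        match I with
        | IPop i n0 n1 n2 n3 n4 =>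
          (st false false (branch (val (g (inord i))) n0 n1 n2 n3 n4),
           senc (Some (upd_track g i 0)), false)
        | _ => (q, s, true)
        end
      | None, _, _ =>
        match I with
        | IPop i n0 n1 n2 n3 n4 => (st false false n0, s, true)
        | _ => (q, s, true)
        end
      end
    end
  end.

Definition machine : TM := @MkTM #|{: ctl}| #|{: cell}| tdelta.

Lemma sencK g : sdec (senc g) = g.
Proof. by rewrite /sdec /senc (unsplitK (inr _ : 'I_5 + _)) enum_rankK. Qed.

Lemma split_qenc q : split (qenc q) = inr (enum_rank q).
Proof. by rewrite /qenc (unsplitK (inr _ : 'I_3 + _)). Qed.

Lemma qenc_running q : (val (qenc q) == 1) || (val (qenc q) == 2) = false.
Proof. by rewrite /qenc /=; apply/negbTE; lia. Qed.

Definition fupd (f : nat -> sym) (p : nat) (s : sym) (j : nat) : sym :=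
  if j == p then s else f j.

(** [f] describes the half tape from the home cell rightwards; the cells to its left are
    unconstrained. The default [ord0] is the blank beyond the stored lists. *)
Definition repr (c : tmconf machine) (p : nat) (f : nat -> sym) : Prop :=
  [/\ chead c = f p, forall j, nth ord0 (cright c) j = f (p + j).+1
    & forall j, j < p -> nth ord0 (cleft c) j = f (p - j.+1)].

Lemma repr_ext c p f g : repr c p f -> f =1 g -> repr c p g.
Proof. by case=> A B C E; split=> [|j|j Hj]; rewrite ?A ?B ?C. Qed.

Lemma step_right c p f q q' s' : repr c p f -> cstate c = qenc q ->
  tdelta (qenc q) (f p) = (q', s', true) ->
  cstate (tm_step c) = q' /\ repr (tm_step c) p.+1 (fupd f p s').
Proof.
move=> [Ha Hb Hc] Hq Hd.
rewrite /tm_step Hq qenc_running Ha /= Hd; split=> //; split=> /=.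
- by rewrite -nth0 Hb /fupd addn0 gtn_eqF.
- move=> j; rewrite nth_behead Hb /fupd; case: eqP; last by rewrite addnS.
  by lia.
- case=> [|j] Hj /=; first by rewrite subn1 /fupd eqxx.
  by rewrite Hc // /fupd subSS; case: eqP => // ?; lia.
Qed.

Lemma step_left c p f q q' s' : repr c p.+1 f -> cstate c = qenc q ->
  tdelta (qenc q) (f p.+1) = (q', s', false) ->
  cstate (tm_step c) = q' /\ repr (tm_step c) p (fupd f p.+1 s').
Proof.
move=> [Ha Hb Hc] Hq Hd.
rewrite /tm_step Hq qenc_running Ha /= Hd; split=> //; split=> /=.
- by rewrite -nth0 Hc // subn1 /fupd ltn_eqF.
- case=> [|j] /=; first by rewrite addn0 /fupd eqxx.
  by rewrite Hb /fupd; case: eqP => [?|_]; [lia | congr f; lia].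
- move=> j Hj; rewrite nth_behead Hc; last lia.
  by rewrite /fupd; case: eqP => [?|_]; [lia | congr f; lia].
Qed.

Lemma iterD_tm (c : tmconf machine) t1 t2 :
  iter (t1 + t2) (@tm_step machine) c = iter t2 (@tm_step machine) (iter t1 (@tm_step machine) c).
Proof. by rewrite addnC iterD. Qed.

Lemma fupd_id f p : fupd f p (f p) =1 f.
Proof. by move=> j; rewrite /fupd; case: eqP => // ->. Qed.

Lemma scan_right q k c p f : repr c p f -> cstate c = qenc q ->
  (forall j, p <= j < p + k -> tdelta (qenc q) (f j) = (qenc q, f j, true)) ->
  let c' := iter k (@tm_step machine) c in cstate c' = qenc q /\ repr c' (p + k) f.
Proof.
elim: k c p => [|k IH] c p R Hq Hd; first by rewrite addn0.
rewrite /= -iterS iterSr addnS -addSn.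
have [Hq' R'] := step_right R Hq (Hd p ltac:(lia)).
apply: IH => //; first exact: repr_ext R' (@fupd_id _ _).
by move=> j Hj; apply: Hd; lia.
Qed.

Lemma scan_left q p c f : repr c p f -> cstate c = qenc q ->
  (forall j, 0 < j <= p -> tdelta (qenc q) (f j) = (qenc q, f j, false)) ->
  let c' := iter p (@tm_step machine) c in cstate c' = qenc q /\ repr c' 0 f.
Proof.
elim: p c => [|p IH] c R Hq Hd //.
rewrite /= -iterS iterSr.
have [Hq' R'] := step_left R Hq (Hd p.+1 ltac:(lia)).
apply: IH => //; first exact: repr_ext R' (@fupd_id _ _).
by move=> j Hj; apply: Hd; lia.
Qed.

(** Digit 0 marks a cell above the top of a stack. The last clause, that stacked symbols are
    positive, makes the top recognisable. *)
Definition tape_ok (f : nat -> sym) (m : memory) : Prop :=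
  [/\ sdec (f 0) = None,
    forall j, exists2 g, sdec (f j.+1) = Some g
      & forall i : 'I_nstk, val (g i) = nth 0 (rev (stk m i)) j
    & forall i, i < nstk -> all (leq 1) (stk m i)].

Definition at_home (c : tmconf machine) (pc : nat) (m : memory) : Prop :=
  cstate c = st false false pc /\ exists2 f, repr c 0 f & tape_ok f m.

Lemma return_home (c : tmconf machine) p f pc m : cstate c = st false false pc -> repr c p f ->
  tape_ok f m -> at_home (iter p (@tm_step machine) c) pc m.
Proof.
move=> Hq R T; have [|A B] := scan_left R Hq; last by split=> //; exists f.
case=> [|j] // _; case: T => _ /(_ j) [g Hg _] _.
by rewrite /tdelta split_qenc enum_rankK Hg.
Qed.

Lemma stk_set m i s j : stk (setstk m i s) j = if j == i then s else stk m j.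
Proof. by rewrite /stk /setstk nth_set_nth. Qed.

Lemma nth_rev_top (s : seq nat) j : all (leq 1) s -> (nth 0 (rev s) j == 0) = (size s <= j).
Proof.
move=> Hs; case: ltnP => Hj; last by rewrite nth_default ?size_rev.
have : nth 0 (rev s) j \in rev s by rewrite mem_nth ?size_rev.
by rewrite mem_rev => /(allP Hs); case: nth.
Qed.

(** An instruction costs one trip to the top of its stack and back, plus a few extra moves; a pop
    from an empty stack bounces between the home cell and its neighbour and takes exactly four
    steps. *)
Lemma istep_sim pc m pc' m' (c : tmconf machine) H : istep (pc, m) (pc', m') -> at_home c pc m ->
  pc < size P -> (forall i, i < nstk -> size (stk m i) <= H) ->
  exists2 t, t <= 2 * H + 4 & at_home (iter t (@tm_step machine) c) pc' m'.
Proof.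
move E1: (pc, m) => s1; move E2: (pc', m') => s2 Hst [Hq [f R T]] Hpc HH.
have [T0 T1 T2] := T.
have Ipc : nat_of_ord (inord pc : 'I_(size P).+1) = pc by rewrite inordK //; lia.
case: Hst E1 E2 => [p1 m1 n HI Hn|p1 m1 i a n HI Hn Hi Ha|p1 m1 i n0 n1 n2 n3 n4 n HI Hb Hn Hi]
  [? ?] [? ?]; subst p1 m1 pc' m'.
- have [|Hq1 R1] := step_right R Hq (q' := st false false n) (s' := f 0).
    by rewrite /tdelta split_qenc enum_rankK T0 Ipc HI.
  exists 2; first lia.
  apply: (return_home (p := 1) (f := f) (c := tm_step c)) => //.
- have [|Hq1 R1] := step_right R Hq (q' := st false true pc) (s' := f 0).
    by rewrite /tdelta split_qenc enum_rankK T0 Ipc HI.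
  have {}R1 := repr_ext R1 (@fupd_id _ _).
  set h := size (stk m i).
  have [|Hq2 R2] := scan_right (k := h) R1 Hq1.
    case=> [|j] // Hj; case: (T1 j) => g Hg Hgi.
    rewrite /tdelta split_qenc enum_rankK Hg /= Ipc HI Hgi inordK // nth_rev_top ?T2 //.
    by rewrite ifN // -ltnNge -/h; lia.
  set c2 := iter h _ _ in Hq2 R2.
  have [g Hg Hgi] := T1 h.
  have [|Hq3 R3] := step_left R2 Hq2 (q' := st false false n) (s' := senc (Some (upd_track g i a))).
    rewrite /tdelta split_qenc enum_rankK Hg /= Ipc HI Hgi inordK // nth_rev_top ?T2 //.
    by rewrite leqnn.
  exists (1 + h + 1 + h).
    by have := HH i Hi; rewrite -/h; lia.
  rewrite !iterD_tm /=; apply: return_home R3 _ => //; split.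
  + by rewrite /fupd.
  + move=> j; case: (eqVneq j h) => [->|Hj].
      rewrite /fupd eqxx sencK; eexists; first by [].
      move=> l; rewrite ffunE stk_set; case: eqP => [_|_].
        by rewrite /= inordK ?rev_cons ?nth_rcons ?size_rev -/h ?ltnn ?eqxx //; case/andP: Ha.
      exact: Hgi.
    rewrite /fupd eqSS (negbTE Hj); have [g' Hg' Hgi'] := T1 j.
    exists g' => // l; rewrite Hgi' stk_set; case: eqP => [->|] //.
    rewrite rev_cons nth_rcons size_rev -/h (negbTE Hj).
    by case: ltnP => // ?; rewrite nth_default // size_rev.
  + move=> l Hl; rewrite stk_set; case: eqP => _; last exact: T2.
    by rewrite /= T2 // andbT; case/andP: Ha.
- have [|Hq1 R1] := step_right R Hq (q' := st true false pc) (s' := f 0).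
    by rewrite /tdelta split_qenc enum_rankK T0 Ipc HI.
  have {}R1 := repr_ext R1 (@fupd_id _ _).
  set h := size (stk m i).
  have [|Hq2 R2] := scan_right (k := h) R1 Hq1.
    case=> [|j] // Hj; case: (T1 j) => g Hg Hgi.
    rewrite /tdelta split_qenc enum_rankK Hg /= Ipc HI Hgi inordK // nth_rev_top ?T2 //.
    by rewrite ifN // -ltnNge -/h; lia.
  set c2 := iter h _ _ in Hq2 R2.
  have [g Hg Hgi] := T1 h.
  have [|Hq3 R3] := step_left R2 Hq2 (q' := st true true pc) (s' := f h.+1).
    rewrite /tdelta split_qenc enum_rankK Hg /= Ipc HI Hgi inordK // nth_rev_top ?T2 //.
    by rewrite leqnn.
  have {}R3 := repr_ext R3 (@fupd_id _ _).
  case Es: (stk m i) => [|a s].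
    have h0 : h = 0 by rewrite /h Es.
    rewrite h0 in R3.
    have [|Hq4 R4] := step_right R3 Hq3 (q' := st false false n0) (s' := f 0).
      by rewrite /tdelta split_qenc enum_rankK T0 Ipc HI.
    have {}R4 := repr_ext R4 (@fupd_id _ _).
    have {Hb} -> : n = n0 by rewrite Hb Es.
    exists (1 + h + 1 + 1 + 1); first lia.
    rewrite !iterD_tm; apply: return_home R4 _ => //; split=> //.
      move=> j; have [g' Hg' Hgi'] := T1 j; exists g' => // l.
      by rewrite stk_set Hgi'; case: eqP => // ->; rewrite Es.
    by move=> l Hl; rewrite stk_set; case: eqP => // _; apply: T2.
  have hS : h = (size s).+1 by rewrite /h Es.
  rewrite hS in R3.
  have [g' Hg' Hgi'] := T1 (size s).
  have Ea : val (g' (inord i)) = a.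
    by rewrite Hgi' inordK // Es rev_cons nth_rcons size_rev ltnn eqxx.
  have [|Hq4 R4] := step_left R3 Hq3
      (q' := st false false (branch a n0 n1 n2 n3 n4)) (s' := senc (Some (upd_track g' i 0))).
    by rewrite /tdelta split_qenc enum_rankK Hg' Ipc HI Ea.
  have {Hb} -> : n = branch a n0 n1 n2 n3 n4 by rewrite Hb Es.
  exists (1 + h + 1 + 1 + size s).
    by have := HH i Hi; rewrite -/h; lia.
  rewrite !iterD_tm /=; apply: return_home R4 _ => //; split.
  + by rewrite /fupd.
  + move=> j; case: (eqVneq j (size s)) => [->|Hj].
      rewrite /fupd eqxx sencK; eexists; first by [].
      move=> l; rewrite ffunE stk_set; case: eqP => [_|Hl].
        by rewrite /= inordK // nth_default ?size_rev.
      by rewrite Hgi'.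
    rewrite /fupd eqSS (negbTE Hj); have [g'' Hg'' Hgi''] := T1 j.
    exists g'' => // l; rewrite Hgi'' stk_set; case: eqP => [->|] //.
    rewrite Es rev_cons nth_rcons size_rev (negbTE Hj).
    by case: ltnP => // ?; rewrite nth_default // size_rev.
  + move=> l Hl; rewrite stk_set; case: eqP => _; last exact: T2.
    by have := T2 _ Hi; rewrite Es => /andP[].
Qed.

Lemma istep_size pc m pc' m' H : istep (pc, m) (pc', m') ->
  (forall i, size (stk m i) <= H) -> forall i, size (stk m' i) <= H.+1.
Proof.
move E1: (pc, m) => s1; move E2: (pc', m') => s2 Hst HH l; have Hl := HH l.
case: Hst E1 E2 => [p1 m1 n _ _|p1 m1 i a n _ _ _ _|p1 m1 i n0 n1 n2 n3 n4 n _ _ _ _]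
  [? ?] [? ?]; subst p1 m1 pc' m'; rewrite ?stk_set; first lia.
  by have := HH i; case: eqP => _ /=; lia.
by have := HH i; case: eqP => _; rewrite ?size_behead; lia.
Qed.

Lemma istep_pc s s' : istep s s' -> s'.1 < size P.
Proof. by by case. Qed.

(** A stack grows by at most one symbol per instruction, so no height exceeds [H + t] and the
    simulation is quadratic in [t]. *)
Lemma isteps_sim t s s' (c : tmconf machine) H : isteps t s s' -> at_home c s.1 s.2 -> s.1 < size P ->
  (forall i, size (stk s.2 i) <= H) ->
  exists2 u, u <= t * (2 * (H + t) + 4) & at_home (iter u (@tm_step machine) c) s'.1 s'.2.
Proof.
move=> Hs; elim: Hs c H => {t s s'} [s|t [p1 m1] [p2 m2] s3 H12 H23 IH] c H Hc Hpc HH.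
  by exists 0.
have [u Hu Hc2] := istep_sim H12 Hc Hpc (fun i _ => HH i).
have [v Hv Hc3] := IH _ _ Hc2 (istep_pc H12) (istep_size H12 HH).
exists (u + v); last by rewrite iterD_tm.
by nia.
Qed.

End Machine.

(** Address 0 accepts and address 1 rejects: normal termination of [c] continues at 0, a [Break]
    outside all loops at 1. *)
Definition program (c : cmd) : seq instr := [:: IAcc; IRej] ++ comp c 2 0 1.

Definition start_mem (x : seq nat) : memory := rev x :: nseq nstk.-1 [::].

Lemma stk_start x i : stk (start_mem x) i = if i == 0 then rev x else [::].
Proof. by case: i => // i; rewrite /stk /start_mem [nth _ _ _]nth_nseq if_same. Qed.

(** The three steps: leave the input to the left, write the home marker while moving right, walk
    back onto it. *)
Lemma machine_init P (x : seq nat) : all (fun a => 0 < a < 5) x ->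
  at_home (iter 3 (@tm_step (machine P)) (tm_init (machine P) x)) 2 (start_mem x).
Proof.
move=> Hx; set c0 := tm_init _ x; set f := fun j => inord (nth 0 x j) : sym.
have Hc0 : cstate c0 = lshift _ (ord0 : 'I_3) by apply/val_inj.
pose f1 j := if j is j'.+1 then f j' else ord0.
have Hnth j : nth ord0 (map (fun a : nat => inord a : sym) x) j = f j.
  have [Hj|Hj] := ltnP j (size x); first by rewrite (nth_map 0).
  rewrite /f !nth_default ?size_map //; by apply/val_inj; rewrite /= val_insubd.
have [Hq1 R1] : cstate (tm_step c0) = qenc (P := P) None /\ repr (tm_step c0) 0 f1.
  rewrite /tm_step Hc0.
  have -> : delta (t := machine P) (lshift _ (ord0 : 'I_3)) (chead c0)
      = (qenc None, chead c0, false).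
    by rewrite /= /tdelta (unsplitK (inl _ : 'I_3 + 'I_ _)).
  rewrite /=; split=> //; split=> //= -[|j] /=; rewrite add0n.
    by rewrite -nth0 Hnth.
  by rewrite nth_behead Hnth.
have [|Hq2 R2] := step_right R1 Hq1 (q' := st P false false 2) (s' := senc None).
  by rewrite /tdelta split_qenc enum_rankK.
rewrite (iterSr 2) (iterSr 1).
apply: return_home Hq2 R2 _; split.
- by rewrite /fupd eqxx sencK.
- move=> j; rewrite /fupd /= /f.
  have Hj5 : nth 0 x j < 5.
    have [Hj|Hj] := ltnP j (size x); last by rewrite nth_default.
    by case/andP: (allP Hx _ (mem_nth 0 Hj)).
  have -> : inord (nth 0 x j) = lshift #|{: cell}| (Ordinal Hj5) :> 'I_(5 + _).
    apply/val_inj; rewrite /= inordK //; apply: leq_trans Hj5 _; exact: leq_addr.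
  rewrite /sdec (unsplitK (inl _ : 'I_5 + 'I_ _)); eexists; first by [].
  move=> i; rewrite ffunE stk_start; case: eqP => _; first by rewrite revK.
  by rewrite nth_nil.
- move=> i _; rewrite stk_start; case: eqP => // _.
  by rewrite all_rev; apply: sub_all Hx => a /andP[].
Qed.

Lemma iter_halted (M : TM) (c : tmconf M) t :
  (val (cstate c) == 1) || (val (cstate c) == 2) -> iter t (@tm_step M) c = c.
Proof. by move=> H; elim: t => //= t ->; rewrite /tm_step H. Qed.

(** The final [4] in [u] pays for the three initial steps and the step into the halting state. After
    [Abort] acceptance is excluded at every time, not only within [u] steps. *)
Lemma machine_correct (c : cmd) (x : seq nat) o t : all (fun a => 0 < a < 5) x ->
  ev c (start_mem x) o t ->
  let M := machine (program c) in
  let u := t * (2 * (size x + t) + 4) + 4 in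
  match o with
  | Norm _ => accepts_within M u x
  | Abort => forall v, ~ accepts_within M v x
  | Brk _ => True
  end.
Proof.
move=> Hx Hev M u; set P := program c.
have HP : size P = (clen c).+2 by rewrite /P /program size_cat size_comp.
have Hcode : code_at P 2 (comp c 2 0 1).
  split=> [|j Hj]; first by rewrite size_comp HP; lia.
  by [].
have [||| m' Hm' Hrun] := comp_correct Hev Hcode; rewrite ?HP //.
have [||v Hv [Hq [f R T]]] := isteps_sim (H := size x) Hrun (machine_init P Hx).
- by rewrite HP /=; have := clen_gt0 c; lia.
- by move=> i; rewrite stk_start; case: eqP => // _; rewrite size_rev.
rewrite -iterD_tm in Hq R.
set cf := iter _ _ _ in Hq R.
have {T} [T0 _ _] := T.
case: o Hev Hrun Hm' Hq => [m1|//|] _ _ _ /= Hq.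
- have [|Hq' _] := step_right R Hq (q' := lshift _ (inord 1 : 'I_3)) (s' := f 0).
    by rewrite /tdelta split_qenc enum_rankK T0 inordK.
  have Hv1 : val (cstate (tm_step cf)) = 1 by rewrite Hq' /= inordK.
  rewrite /accepts_within.
  have -> : u = (3 + v).+1 + (u - (3 + v).+1) by rewrite /u; lia.
  by rewrite iterD_tm iter_halted ?Hv1.
- have [|Hq' _] := step_right R Hq (q' := lshift _ (inord 2 : 'I_3)) (s' := f 0).
    by rewrite /tdelta split_qenc enum_rankK T0 inordK // HP.
  have Hv2 : val (cstate (tm_step cf)) = 2 by rewrite Hq' /= inordK.
  move=> w; rewrite /accepts_within => Hw.
  (* Halting states are absorbing, so acceptance before or after the rejecting configuration would
     contradict it. *)
  have [Hle|Hle] := leqP w (3 + v).+1.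
    move: Hv2; rewrite /cf -iterS.
    have -> : (3 + v).+1 = w + ((3 + v).+1 - w) by lia.
    by rewrite iterD_tm iter_halted ?Hw.
  move: Hw; have -> : w = (3 + v).+1 + (w - (3 + v).+1) by lia.
  by rewrite iterD_tm iter_halted ?Hv2.
Qed.

(** * Verifier: rule expansion *)

Definition evs (c : cmd) (m : memory) (o : outcome) (B : nat) : Prop :=
  exists2 t, t <= B & ev c m o t.

Lemma evs_le c m o B B' : evs c m o B -> B <= B' -> evs c m o B'.
Proof. by case=> t Ht H HB; exists t => //; apply: leq_trans HB. Qed.

Lemma evs_seq c d m m1 o B1 B2 :
  evs c m (Norm m1) B1 -> evs d m1 o B2 -> evs (Seq c d) m o (B1 + B2).
Proof.
by case=> t1 L1 H1 [t2 L2 H2]; exists (t1 + t2); [lia | apply: ev_seq H1 H2].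
Qed.

Lemma evs_seq_abort c d m B : evs c m Abort B -> evs (Seq c d) m Abort B.
Proof. by case=> t L H; exists t => //; apply: ev_seq_abort. Qed.

Lemma evs_seq_brk c d m m1 B : evs c m (Brk m1) B -> evs (Seq c d) m (Brk m1) B.
Proof. by case=> t L H; exists t => //; apply: ev_seq_brk. Qed.

Lemma evs_loop c m m1 o B1 B2 :
  evs c m (Norm m1) B1 -> evs (Loop c) m1 o B2 -> evs (Loop c) m o (B1 + B2).
Proof.
by case=> t1 L1 H1 [t2 L2 H2]; exists (t1 + t2); [lia | apply: ev_loop H1 H2].
Qed.

Lemma evs_loop_abort c m B : evs c m Abort B -> evs (Loop c) m Abort B.
Proof. by case=> t L H; exists t => //; apply: ev_loop_abort. Qed.

Lemma evs_loop_brk c m m1 B : evs c m (Brk m1) B -> evs (Loop c) m (Norm m1) B.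
Proof. by case=> t L H; exists t => //; apply: ev_loop_brk. Qed.

Lemma evs_pop i c0 c1 c2 c3 c4 m o B : i < nstk ->
  evs (branch (head 0 (stk m i)) c0 c1 c2 c3 c4) (setstk m i (behead (stk m i))) o B ->
  evs (Pop i c0 c1 c2 c3 c4) m o B.+1.
Proof. by move=> Hi [t L H]; exists t.+1 => //; apply: ev_pop. Qed.

Lemma evs_push i a m m' : i < nstk -> 0 < a < 5 -> m' = setstk m i (a :: stk m i) ->
  evs (Push i a) m (Norm m') 1.
Proof. by move=> Hi Ha ->; exists 1 => //; apply: ev_push. Qed.

Lemma evs_skip m : evs Skip m (Norm m) 1.
Proof. by exists 1 => //; apply: ev_skip. Qed.

Lemma evs_break m : evs Break m (Brk m) 1.
Proof. by exists 1 => //; apply: ev_break. Qed.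

Lemma evs_fail m : evs Fail m Abort 1.
Proof. by exists 1 => //; apply: ev_fail. Qed.

(** The commands of the verifier are specified by functions on strings with optional results
    ([select], [expand], [run], [blocks]); [None] there corresponds to a rejecting evaluation. *)
Definition onorm (x : option memory) : outcome := if x is Some m then Norm m else Abort.

Lemma mem_ext (m1 m2 : memory) : size m1 = size m2 -> stk m1 =1 stk m2 -> m1 = m2.
Proof. by move=> Hs H; apply: (@eq_from_nth _ [::]) => // i _; apply: H. Qed.

Lemma size_setstk m i s : size m = nstk -> i < nstk -> size (setstk m i s) = nstk.
Proof. by move=> <- Hi; rewrite /setstk size_set_nth; apply/maxn_idPr. Qed.

Fixpoint pushes (js : seq nat) (a : nat) : cmd :=
  if js is j :: js' then Seq (pushes js' a) (Push j a) else Skip.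

Definition pushall (js : seq nat) (u : seq nat) (m : memory) : memory :=
  foldr (fun j m' => setstk m' j (rev u ++ stk m' j)) m js.

(* Moves symbols from stack [i] to all stacks in [js] up to and including the symbol [stop],
   which is dropped; [stop = 0] means until [i] is empty. *)
Definition xfer_body (i : nat) (js : seq nat) (stop a : nat) : cmd :=
  if a == stop then Break else pushes js a.
Definition XFER (i : nat) (js : seq nat) (stop : nat) : cmd :=
  Loop (Pop i (if stop == 0 then Break else Fail)
    (xfer_body i js stop 1) (xfer_body i js stop 2)
    (xfer_body i js stop 3) (xfer_body i js stop 4)).

Lemma size_pushall js u m : size m = nstk -> all (fun j => j < nstk) js ->
  size (pushall js u m) = nstk.
Proof. by move=> Hm; elim: js => //= j js IH /andP[Hj /IH E]; rewrite size_setstk ?E. Qed.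

Lemma stk_pushall js u m l : uniq js ->
  stk (pushall js u m) l = if l \in js then rev u ++ stk m l else stk m l.
Proof.
elim: js l => //= j js IH l /andP[Hj Hu]; rewrite stk_set inE.
by case: eqP => [->|_] /=; rewrite IH // (negbTE Hj).
Qed.

Lemma evs_pushes js a m : all (fun j => j < nstk) js -> 0 < a < 5 ->
  evs (pushes js a) m (Norm (pushall js [:: a] m)) (size js).+1.
Proof.
move=> + Ha; elim: js => [|j js IH] /=; first by move=> _; apply: evs_skip.
case/andP=> Hj /IH H; apply: evs_le (evs_seq H (evs_push Hj Ha (erefl _))) _; lia.
Qed.

Section Xfer.
Variables (i : nat) (js : seq nat) (stop : nat).
Hypotheses (Hi : i < nstk) (Hjs : all (fun j => j < nstk) js) (Hu : uniq js) (Hij : i \notin js).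
Let ok a := (0 < a < 5) && (a != stop).

Lemma xfer_branch a c0 : 0 < a < 5 ->
  branch a c0
    (xfer_body i js stop 1) (xfer_body i js stop 2)
    (xfer_body i js stop 3) (xfer_body i js stop 4) = xfer_body i js stop a.
Proof. by case: a => [|[|[|[|[|a]]]]]. Qed.

(** The iteration shared by completed and aborted transfers. The last clause says that the rest of
    the transfer, started from [m1], ends where the whole transfer from [m] ends. *)
Lemma xfer_step m a s : ok a -> size m = nstk -> stk m i = a :: s ->
  exists m1, [/\ size m1 = nstk, stk m1 i = s,
    (forall o B, evs (XFER i js stop) m1 o B ->
       evs (XFER i js stop) m o ((size js).+3 + B)) &
    forall u v, pushall js u (setstk m1 i v) = pushall js (a :: u) (setstk m i v)].
Proof.
case/andP=> Ha Hs Hm Es; exists (pushall js [:: a] (setstk m i s)).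
have S1 : size (setstk m i s) = nstk by rewrite size_setstk.
have S2 : size (pushall js [:: a] (setstk m i s)) = nstk by rewrite size_pushall.
split=> //.
- by rewrite stk_pushall // (negbTE Hij) stk_set eqxx.
- move=> o B H; apply: evs_le (evs_loop (evs_pop Hi _) H) _.
    rewrite Es /= xfer_branch // /xfer_body (negbTE Hs).
    exact: evs_pushes.
  by lia.
- move=> u v; apply: mem_ext.
    by rewrite !size_pushall ?size_setstk.
  move=> l; rewrite !(stk_pushall, stk_set) //.
  case: (eqVneq l i) => [->|_]; first by rewrite (negbTE Hij).
  by case: (l \in js); rewrite ?(rev_cons a u) -?cats1 -?catA.
Qed.

Lemma xfer_ok m u v m' : size m = nstk -> all ok u ->
  stk m i = u ++ (if stop == 0 then [::] else stop :: v) ->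
  (stop == 0 -> v = [::]) -> stop < 5 ->
  m' = pushall js u (setstk m i v) ->
  evs (XFER i js stop) m (Norm m') ((size u).+1 * (size js + 3)).
Proof.
move=> + + + Hv H5 ->; elim: u m => [|a u IH] m Hm /=.
  move=> _ Es.
  have -> : pushall js [::] (setstk m i v) = setstk m i v.
    by apply: mem_ext => [|l]; rewrite ?size_pushall ?size_setstk // stk_pushall // if_same.
  apply: evs_le (evs_loop_brk (evs_pop (B := 1) Hi _)) _; last lia.
  move: Es Hv; case: (eqVneq stop 0) => [E0|Hs] -> Hv.
    by rewrite Hv //; apply: evs_break.
  by rewrite xfer_branch ?lt0n ?Hs // /xfer_body eqxx; apply: evs_break.
case/andP=> Ha Hal Es.
have [m1 [S1 E1 R1 P1]] := xfer_step Ha Hm Es.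
have := R1 _ _ (IH _ S1 Hal E1); rewrite P1 => /evs_le; apply; lia.
Qed.

Lemma xfer_abort m : size m = nstk -> all ok (stk m i) -> stop != 0 ->
  evs (XFER i js stop) m Abort ((size (stk m i)).+1 * (size js + 3)).
Proof.
move=> Hm Ha Hs; move Es: (stk m i) Ha => s.
elim: s m Hm Es => [|a s IH] m Hm Es.
  move=> _; apply: evs_le (evs_loop_abort (evs_pop (B := 1) Hi _)) _; last lia.
  rewrite Es (negbTE Hs); exact: evs_fail.
case/andP=> Ha Hal.
have [m1 [S1 E1 R1 _]] := xfer_step Ha Hm Es.
have := R1 _ _ (IH _ S1 E1 Hal) => /evs_le; apply => /=; lia.
Qed.

End Xfer.

Infix ";;" := Seq (at level 60, right associativity).
Definition bit (a : nat) : bool := (a == 1) || (a == 2).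
Definition trit (a : nat) : bool := bit a || (a == 3).

(* A grammar rule as a pair [(lhs, rhs)] of strings. *)
Definition entry := (seq nat * seq nat)%type.
(** Inside a right side every symbol ends with 3, so an entry needs the further end marker 4. *)
Definition flat1 (e : entry) : seq nat := e.1 ++ 3 :: e.2 ++ [:: 4].
Definition flat (es : seq entry) : seq nat := flatten (map flat1 es).
Definition wfe (e : entry) : bool := all bit e.1 && all trit e.2.

(* Stacks: 0 scratch, 1 certificate, 2 instance, 3 rule list, 4 part of the rule list that has been
   passed, 5 sentential form, 6 letters seen, 7 alphabet size, 8 start symbol, 9 counter. *)

Definition SELECT : cmd :=
  Loop (Pop 1 Fail (XFER 3 [:: 4] 4 ;; Push 4 4) Break Fail Fail).
(** The left side is moved to stack 4 while it is compared, so that the rule list can be rebuilt;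
    the common end marker 3 rules out proper prefixes. *)
Definition MATCH : cmd :=
  Loop (Pop 3 Fail
    (Push 4 1 ;; Pop 5 Fail Skip Fail Fail Fail)
    (Push 4 2 ;; Pop 5 Fail Fail Skip Fail Fail)
    (Push 4 3 ;; Pop 5 Fail Fail Fail Break Fail) Fail).
Definition EXPAND : cmd :=
  SELECT ;; MATCH ;; XFER 3 [:: 4; 0] 4 ;; Push 4 4 ;; XFER 0 [:: 5] 0 ;; XFER 4 [:: 3] 0.
(** A terminal is stored on stack 6 as the reversed entry of a rule [a -> eps]. Read backwards,
    stack 6 is thus a rule list on which [EXPAND] can search for letters. *)
Definition RUN : cmd :=
  Loop (Pop 5 Break (XFER 5 [:: 6] 3 ;; Push 6 3 ;; Push 6 4) EXPAND Fail Fail).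

Fixpoint select (C : seq nat) (dn es : seq entry) : option (seq nat * seq entry * seq entry) :=
  match C with
  | 1 :: C' => if es is e :: es' then select C' (e :: dn) es' else None
  | 2 :: C' => Some (C', dn, es)
  | _ => None
  end.

Definition expand (es : seq entry) (C W : seq nat) : option (seq nat * seq nat) :=
  match select C [::] es with
  | Some (C', _, (u, rhs) :: _) =>
    if take (size u).+1 W == rcons u 3 then Some (C', rhs ++ drop (size u).+1 W) else None
  | _ => None
  end.

Lemma flat_cons e es : flat (e :: es) = e.1 ++ 3 :: e.2 ++ 4 :: flat es.
Proof. by rewrite /flat /= /flat1 -!catA /= -catA. Qed.

Lemma flat_cat es1 es2 : flat (es1 ++ es2) = flat es1 ++ flat es2.
Proof. by rewrite /flat map_cat flatten_cat. Qed.

Definition okay (stop a : nat) : bool := (0 < a < 5) && (a != stop).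

Lemma bits_okay stop s : all bit s -> stop \notin [:: 1; 2] -> all (okay stop) s.
Proof.
move=> H Hs; apply: sub_all H => a; move: Hs.
by rewrite !inE /okay => /norP[A B] /orP[] /eqP ->; rewrite eq_sym.
Qed.

Lemma trits_okay stop s : all trit s -> stop \notin [:: 1; 2; 3] -> all (okay stop) s.
Proof.
move=> H Hs; apply: sub_all H => a; move: Hs.
by rewrite !inE /okay => /norP[A /norP[B C]] /orP[/orP[]|] /eqP ->; rewrite eq_sym.
Qed.

Definition xfer_side i js := [&& i < nstk, all (fun j => j < nstk) js, uniq js & i \notin js].

Lemma evs_until i js stop m u v m' : xfer_side i js -> 0 < stop < 5 -> size m = nstk ->
  stk m i = u ++ stop :: v -> all (okay stop) u -> m' = pushall js u (setstk m i v) ->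
  evs (XFER i js stop) m (Norm m') ((size u).+1 * (size js + 3)).
Proof.
case/and4P=> Hi Hj Hu Hij /andP[H0 H5] Hm Es Ha ->.
by apply: (@xfer_ok i js stop Hi Hj Hu Hij m u v) => //; case: (stop) H0 Es.
Qed.

Lemma evs_move i js m u m' : xfer_side i js -> size m = nstk ->
  stk m i = u -> all (okay 0) u -> m' = pushall js u (setstk m i [::]) ->
  evs (XFER i js 0) m (Norm m') ((size u).+1 * (size js + 3)).
Proof.
case/and4P=> Hi Hj Hu Hij Hm Es Ha ->.
by apply: (@xfer_ok i js 0 Hi Hj Hu Hij m u [::]) => //; rewrite cats0.
Qed.

Lemma evs_until_abort i js stop m u : xfer_side i js -> stop != 0 -> size m = nstk ->
  stk m i = u -> all (okay stop) u ->
  evs (XFER i js stop) m Abort ((size u).+1 * (size js + 3)).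
Proof.
by case/and4P=> Hi Hj Hu Hij H0 Hm <- Ha; apply: xfer_abort.
Qed.

Ltac cost := do 4 rewrite /= ?(flat_cons, size_cat, size_rev); lia.
Ltac pop := eapply evs_pop; [by [] | simpl].
Ltac lit := simpl; rewrite ?cats0 ?revK; reflexivity.
Ltac push := eapply evs_push; [by [] | by [] | lit].
Ltac until_ u v := eapply (@evs_until _ _ _ _ u v); [by [] | by [] | by [] | | | lit].
Ltac move_ := eapply evs_move; [by [] | by [] | lit | | lit].
Ltac halt := first [exact: evs_fail | exact: evs_break | exact: evs_skip].

Lemma rev_flat_rcons es e :
  rev (flat (rcons es e)) = 4 :: rev e.2 ++ 3 :: rev e.1 ++ rev (flat es).
Proof.
rewrite -cats1 flat_cat rev_cat flat_cons (_ : flat [::] = [::]) //.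
by rewrite !(rev_cat, rev_cons) /= -!cats1 /= -!catA.
Qed.

Lemma select_ok C dn es T R W S K A N :
  all bit C -> all wfe es ->
  evs SELECT [:: T; C; R; flat es; rev (flat (rev dn)); W; S; K; A; N]
    (onorm (omap (fun x : seq nat * seq entry * seq entry =>
       [:: T; x.1.1; R; flat x.2; rev (flat (rev x.1.2)); W; S; K; A; N])
       (select C dn es)))
    (7 * (size C + size (flat es)).+1).
Proof.
move=> HC; elim: C HC dn es => [|a C IH].
  by move=> _ dn es _; eapply evs_le; [eapply evs_loop_abort; pop; halt | cost].
case/andP=> /orP[] /eqP -> HC dn es Hes; last first.
  by eapply evs_le; [eapply evs_loop_brk; pop; halt | cost].
case: es Hes => [|e es] /=.
  move=> _; eapply evs_le.
    eapply evs_loop_abort; pop; eapply evs_seq_abort.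
    by eapply evs_until_abort; [| | | simpl; reflexivity |].
  by cost.
case/andP=> /andP[He1 He2] Hes; eapply evs_le.
  eapply evs_loop.
    pop; eapply evs_seq.
      until_ (e.1 ++ 3 :: e.2) (flat es); first by rewrite /stk /= flat_cons -catA.
      by rewrite all_cat /= bits_okay // trits_okay.
    push.
  have := IH HC (e :: dn) es Hes; rewrite rev_cons rev_flat_rcons.
  by rewrite rev_cat rev_cons cat_rcons -catA; apply.
by cost.
Qed.

Lemma select_eq C dn es C' dn' es' : select C dn es = Some (C', dn', es') ->
  [/\ rev dn' ++ es' = rev dn ++ es, size C' < size C & all bit C -> all bit C'].
Proof.
elim: C dn es => //= a C IH dn es; case: a => [|[|[|a]]] //.
  case: es => // e es /IH[-> H1 H2]; split; [by rewrite rev_cons cat_rcons | by lia |].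
  by case/andP=> _ /H2.
by case=> <- <- <-; split=> // /andP[].
Qed.

Lemma match_ok u X T C R M W S K A N : all bit u ->
  evs MATCH [:: T; C; R; u ++ 3 :: X; M; W; S; K; A; N]
    (onorm (if take (size u).+1 W == rcons u 3 then
       Some [:: T; C; R; X; 3 :: rev u ++ M; drop (size u).+1 W; S; K; A; N] else None))
    (5 * (size u).+1).
Proof.
elim: u M W => [|a u IH] M W.
  move=> _; case: W => [|b W].
    by eapply evs_le; [eapply evs_loop_abort; pop; eapply evs_seq; [push|pop; halt] | cost].
  rewrite /= take0 drop0 eqseq_cons andbT; case: b => [|[|[|[|[|b]]]]] /=;
  try by eapply evs_le; [eapply evs_loop_abort; pop; eapply evs_seq; [push|pop; halt] | cost].
  by eapply evs_le; [eapply evs_loop_brk; pop; eapply evs_seq; [push|pop; halt] | cost].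
case/andP=> Ha Hu; case: W => [|b W].
  by case/orP: Ha => /eqP ->;
    (eapply evs_le; [eapply evs_loop_abort; pop; eapply evs_seq; [push|pop; halt] | cost]).
rewrite [take _ _]/= rcons_cons eqseq_cons [drop _ _]/= rev_cons cat_rcons.
case/orP: Ha => /eqP ->; case: b => [|[|[|[|[|b]]]]] /=;
  try by eapply evs_le; [eapply evs_loop_abort; pop; eapply evs_seq; [push|pop; halt] | cost].
- eapply evs_le; [eapply evs_loop; [pop; eapply evs_seq; [push|pop; halt] | exact: IH] | cost].
- eapply evs_le; [eapply evs_loop; [pop; eapply evs_seq; [push|pop; halt] | exact: IH] | cost].
Qed.

(** The cost is independent of [W]: only a prefix as long as the left side is read, and the new
    right side is pushed on top of the rest. *)
Lemma expand_ok C es R W S K A N : all bit C -> all wfe es ->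
  evs EXPAND [:: [::]; C; R; flat es; [::]; W; S; K; A; N]
    (onorm (omap (fun x : seq nat * seq nat =>
       [:: [::]; x.1; R; flat es; [::]; x.2; S; K; A; N]) (expand es C W)))
    (50 * (size C + size (flat es)).+1).
Proof.
move=> HC Hes; have := @select_ok C [::] es [::] R W S K A N HC Hes.
rewrite /expand /EXPAND; case E: select => [[[C' dn] es']|] /=; last first.
  by move=> H; eapply evs_le; [eapply evs_seq_abort; exact: H | cost].
have [Ees _ _] := select_eq E; rewrite /= in Ees.
case: es' {E} Ees => [|[u rhs] es'] Ees H1.
  eapply evs_le; [eapply evs_seq; [exact: H1|] | ].
    by eapply evs_seq_abort, evs_loop_abort; pop; halt.
  by cost.
have Hf : flat es = flat (rev dn) ++ u ++ 3 :: rhs ++ 4 :: flat es'.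
  by rewrite -Ees flat_cat flat_cons.
have /andP[Hu Hr] : wfe (u, rhs).
  by apply: (allP Hes); rewrite -Ees mem_cat inE eqxx orbT.
rewrite flat_cons /= in H1.
have H2 := @match_ok u (rhs ++ 4 :: flat es') [::] C' R (rev (flat (rev dn))) W S K A N Hu.
case: eqP H2 => _ /= H2; last first.
  eapply evs_le; [eapply evs_seq; [exact: H1|eapply evs_seq_abort; exact: H2] | ].
  by rewrite Hf; cost.
eapply evs_le.
  eapply evs_seq; first exact: H1.
  eapply evs_seq; first exact: H2.
  eapply evs_seq; first by until_ rhs (flat es'); [simpl; reflexivity | rewrite trits_okay].
  eapply evs_seq; first by push.
  eapply evs_seq; first by move_; rewrite all_rev trits_okay.
  eapply evs_move; [by [] | by [] | simpl; reflexivity | | ].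
    rewrite /= all_cat /= all_rev trits_okay //= all_cat /= all_rev bits_okay //=.
    rewrite all_rev /flat; apply/allP => a /flattenP[s /mapP[e He ->]].
    have /andP[He1 He2] : wfe e by apply: (allP Hes); rewrite -Ees mem_cat He.
    move: a; apply/allP; rewrite all_cat /= bits_okay //= all_cat trits_okay //.
  by rewrite /= Hf !(rev_cons, rev_cat, revK) -!cats1 -!catA /=.
by rewrite Hf; cost.
Qed.

(** * Verifier: derivations *)

(** The strict decrease of the certificate is what bounds the number of expansions in any run. *)
Lemma expand_spec es C W C' W' : expand es C W = Some (C', W') ->
  [/\ exists u rhs W2, [/\ (u, rhs) \in es, W = u ++ 3 :: W2 & W' = rhs ++ W2],
      size C' < size C & all bit C -> all bit C'].
Proof.
rewrite /expand; case E: select => [[[C1 dn] [|[u rhs] es']]|] //.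
case: eqP => // Hu [<- <-]; have [Ees H1 H2] := select_eq E.
split=> //; exists u, rhs, (drop (size u).+1 W); split=> //.
  by rewrite -[es]/(rev [::] ++ es) -Ees mem_cat inE eqxx orbT.
by rewrite -cat_rcons -Hu cat_take_drop.
Qed.

Lemma size_flat_mem e es : e \in es -> size e.1 + size e.2 + 2 <= size (flat es).
Proof.
elim: es => //= e' es IH; rewrite inE flat_cons size_cat /= size_cat /=.
by case/orP=> [/eqP <-|/IH]; lia.
Qed.

Fixpoint run (n : nat) (es : seq entry) (C W : seq nat) (ws : seq (seq nat)) :
    option (seq nat * seq (seq nat)) :=
  if n is n'.+1 then
    match W with
    | [::] => Some (C, ws)
    | 1 :: W1 =>
      if 3 \in W1 then run n' es C (drop (index 3 W1).+1 W1) (take (index 3 W1) W1 :: ws)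
      else None
    | 2 :: W1 => if expand es C W1 is Some (C', W') then run n' es C' W' ws else None
    | _ => None
    end
  else None.

Definition seen_str (ws : seq (seq nat)) : seq nat := flatten [seq 4 :: 3 :: rev u | u <- ws].

Lemma split_index3 (W : seq nat) : 3 \in W ->
  W = take (index 3 W) W ++ 3 :: drop (index 3 W).+1 W.
Proof.
by move=> H; rewrite -{1}(cat_take_drop (index 3 W) W) (drop_nth 0) ?index_mem // nth_index.
Qed.

Lemma take_index3 (W : seq nat) : all trit W -> all bit (take (index 3 W) W).
Proof.
elim: W => //= a W IH /andP[Ha /IH]; case: eqP => //= Ha3 ->.
by move: Ha; rewrite /trit; case: eqP => // _; rewrite orbF andbT.
Qed.

Lemma notin3 (W : seq nat) : all trit W -> 3 \notin W -> all bit W.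
Proof.
elim: W => //= a W IH /andP[Ha /IH H]; rewrite inE negb_or eq_sym => /andP[Ha3 /H ->].
by move: Ha; rewrite /trit (negbTE Ha3) orbF andbT.
Qed.

(** The measure [size C * (size (flat es)).+1 + size W] decreases: an expansion consumes a
    certificate symbol and lengthens [W] by less than [size (flat es)], a terminal only shortens
    [W]. So fuel above the measure never runs out, and [None] always is a genuine rejection. *)
Lemma run_ok n es C W ws R K A N :
  all bit C -> all wfe es -> all trit W ->
  size C * (size (flat es)).+1 + size W < n ->
  evs RUN [:: [::]; C; R; flat es; [::]; W; seen_str ws; K; A; N]
    (onorm (omap (fun x : seq nat * seq (seq nat) =>
       [:: [::]; x.1; R; flat es; [::]; [::]; seen_str x.2; K; A; N]) (run n es C W ws)))
    (n * (60 * (n + size (flat es)))).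
Proof.
move=> + Hes; elim: n C W ws => // n IH C W ws HC HW Hn.
have Hsz : size C <= n by nia.
case: W HW Hn => [|[|[|[|[|a]]]] W] //=.
- by move=> _ _; eapply evs_le; [eapply evs_loop_brk; pop; halt | nia].
- move=> HW Hn; case: ifP => [H3|/negbT H3]; last first.
    eapply evs_le.
      eapply evs_loop_abort; pop; eapply evs_seq_abort, evs_until_abort; [by []|by []|by []|lit|].
      by rewrite bits_okay ?notin3.
    by rewrite /=; nia.
  set u := take _ _; set W2 := drop _ _.
  have EW : W = u ++ 3 :: W2 by apply: split_index3.
  have HW2 : all trit W2 by move: HW; rewrite EW all_cat /= => /andP[].
  have Hs : size W = size u + (size W2).+1 by rewrite {1}EW size_cat.
  eapply evs_le.
    eapply evs_loop.
      pop; eapply evs_seq; first by until_ u W2; [exact: EW | rewrite bits_okay ?take_index3].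
      eapply evs_seq; push.
    by apply: (IH C W2 (u :: ws)) => //; lia.
  by rewrite /=; nia.
- move=> HW Hn; have HE := @expand_ok C es R W (seen_str ws) K A N HC Hes.
  case E: expand HE => [[C' W']|] HE; last first.
    by eapply evs_le; [eapply evs_loop_abort; pop; exact: HE | nia].
  have [[u [rhs [W2 [Hin EW EW']]]] HsC /(_ HC) HC'] := expand_spec E.
  have := size_flat_mem Hin; have /andP[/= Hu Hr] := allP Hes _ Hin.
  move: HW Hn HE; rewrite EW EW' all_cat /= size_cat /= => /andP[_ HW2] Hn HE Hsm.
  eapply evs_le.
    eapply evs_loop; first by pop; exact: HE.
    by apply: IH => //; [rewrite all_cat Hr | rewrite size_cat; nia].
  by nia.
- by move=> _ _; eapply evs_le; [eapply evs_loop_abort; pop; halt | nia].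
Qed.

(** A terminal occupies as many symbols among the letters seen (with markers 3 and 4) as in the
    sentential form (with tag and marker 3), so the measure bounding the run also bounds
    [seen_str]. *)
Lemma run_spec n es C W ws C' ws' : all wfe es -> run n es C W ws = Some (C', ws') ->
  all bit C -> all trit W -> all (all bit) ws ->
  [/\ size C' <= size C, all bit C', all (all bit) ws' &
    size (seen_str ws') <= size (seen_str ws) + size C * (size (flat es)).+1 + size W].
Proof.
move=> Hes; elim: n C W ws => // n IH C W ws /=.
case: W => [|[|[|[|[|a]]]] W] //=.
- by case=> <- <- *; split=> //; lia.
- case: ifP => // H3 /IH; set u := take _ _; set W2 := drop _ _ => H HC HW Hws.
  have EW : W = u ++ 3 :: W2 by apply: split_index3.
  have HW2 : all trit W2 by move: HW; rewrite EW all_cat /= => /andP[].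
  have Hs : size W = size u + (size W2).+1 by rewrite {1}EW size_cat.
  case: H => //; first by rewrite /= take_index3.
  have E5 : size (seen_str (u :: ws)) = (size u + size (seen_str ws)).+2.
    by rewrite /seen_str /= size_cat size_rev.
  by rewrite E5 => H1 H2 H4 H5; split=> //; lia.
- case E: expand => [[C1 W']|] // /IH H HC HW Hws.
  have [[u [rhs [W2 [Hin EW EW']]]] HsC /(_ HC) HC'] := expand_spec E.
  have := size_flat_mem Hin; have /andP[/= Hu Hr] := allP Hes _ Hin.
  move: HW; rewrite EW all_cat /= size_cat /= => /andP[_ HW2] Hsm.
  case: H => //; first by rewrite EW' all_cat Hr.
  rewrite EW' size_cat => H1 H2 H3 H4; split=> //; first exact: leq_trans H1 (ltnW HsC).
  set F := (size (flat es)).+1 in Hsm H4 *.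
  have : size C1 * F + F <= size C * F by rewrite addnC -mulSn leq_mul2r HsC orbT.
  by move: H4 Hsm; rewrite {}/F; clear; lia.
Qed.

Lemma seen_okay ws : all (all bit) ws -> all (okay 0) (seen_str ws).
Proof.
elim: ws => //= u ws IH /andP[Hu /IH H].
by rewrite /seen_str /= all_cat all_rev bits_okay.
Qed.

(** A certificate has only the symbols 1 and 2 and hence no separator; a self-delimiting code is
    used, with 2 before each bit and 1 at the end. *)
Definition READB : cmd :=
  Loop (Pop 1 Fail Break (Pop 1 Fail (Push 0 1) (Push 0 2) Fail Fail) Fail Fail).

Fixpoint readB (C acc : seq nat) : option (seq nat * seq nat) :=
  match C with
  | 1 :: C' => Some (acc, C')
  | 2 :: b :: C' => readB C' (b :: acc)
  | _ => None
  end.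

Lemma readB_ok C T R L M W S K A N : all bit C ->
  evs READB [:: T; C; R; L; M; W; S; K; A; N]
    (onorm (omap (fun x : seq nat * seq nat =>
       [:: x.1; x.2; R; L; M; W; S; K; A; N]) (readB C T)))
    (5 * (size C).+1).
Proof.
elim: {C}(size C) {-2}C (leqnn (size C)) T => [|n IH] C.
  case: C => // _ T _.
  by eapply evs_le; [eapply evs_loop_abort; pop; halt | cost].
case: C => [|a C] Hn T.
  by move=> _; eapply evs_le; [eapply evs_loop_abort; pop; halt | cost].
case/andP=> /orP[] /eqP ->.
  by move=> _; eapply evs_le; [eapply evs_loop_brk; pop; halt | cost].
case: C Hn => [|b C] Hn.
  by move=> _; eapply evs_le; [eapply evs_loop_abort; pop; pop; halt | cost].
rewrite /= in Hn.
case/andP=> /orP[] /eqP -> HC; eapply evs_le.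
- by eapply evs_loop; [pop; pop; push | apply: (IH C _ (1 :: T)) => //; lia].
- by cost.
- by eapply evs_loop; [pop; pop; push | apply: (IH C _ (2 :: T)) => //; lia].
- by cost.
Qed.

Lemma readB_spec C acc B C' : readB C acc = Some (B, C') -> all bit C -> all bit acc ->
  [/\ all bit B, all bit C' & 2 * size B + (size C').+1 = 2 * size acc + size C].
Proof.
elim: {C}(size C) {-2}C (leqnn (size C)) acc => [|n IH] C; first by case: C.
case: C => [|[|[|[|a]]] C] //= Hn acc.
  by case=> <- <- ? ?; split=> //; lia.
case: C Hn => [|b C] // Hn /IH H /andP[Hb HC] Hacc; case: H => //.
- by rewrite /= in Hn; lia.
- by rewrite /= Hb.
- by move=> H1 H2 H3; split=> //; rewrite /= in H3 *; lia.
Qed.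

Definition fuel (es : seq entry) (C W : seq nat) : nat :=
  (size C * (size (flat es)).+1 + size W).+1.
Definition runF es C W := run (fuel es C W) es C W [::].

Definition nt_str (u : seq nat) : seq nat := 2 :: u ++ [:: 3].

(** The letters derived from [B] are discarded, only success counts. The new rule goes to the front
    of the list, so later blocks use shifted positions. *)
Fixpoint blocks (n : nat) (es : seq entry) (C : seq nat) : option (seq nat * seq entry) :=
  if n is n'.+1 then
    match C with
    | 1 :: C' => Some (C', es)
    | 2 :: C1 =>
      if readB C1 [::] is Some (B, C2) then
        if runF es C2 (nt_str (rev B)) is Some (C3, _) then blocks n' ((rev B, [::]) :: es) C3
        else None
      else None
    | _ => None
    end
  else None.

Definition BLOCKS : cmd :=
  Loop (Pop 1 Fail Break
    (READB ;; Push 5 3 ;; XFER 0 [:: 5; 9] 0 ;; Push 5 2 ;; RUN ;;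
     Push 3 4 ;; Push 3 3 ;; XFER 9 [:: 0] 0 ;; XFER 0 [:: 3] 0 ;; XFER 6 [::] 0) Fail Fail).

(** A block spends at least [2 * size B + 2] certificate symbols and adds [size B + 2] symbols to
    the rule list, so [size C + size (flat es)] never grows past [G]. The fuel of each run is at
    most [(G + 2) ^ 2], and a run is quadratic in that. *)
Lemma blocks_ok n es C R K A G : all bit C -> all wfe es -> size C < n ->
  size C + size (flat es) <= G ->
  evs BLOCKS [:: [::]; C; R; flat es; [::]; [::]; [::]; K; A; [::]]
    (onorm (omap (fun x : seq nat * seq entry =>
       [:: [::]; x.1; R; flat x.2; [::]; [::]; [::]; K; A; [::]]) (blocks n es C)))
    (n * (200 * ((G + 2) ^ 2) ^ 2)).
Proof.
elim: n es C => // n IH es C HC Hes Hn HG.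
set Q := (G + 2) ^ 2; have HQ : Q = (G + 2) * (G + 2) by rewrite /Q expnS expn1.
have HGQ : G + 2 <= Q by rewrite HQ; nia.
have HQQ : Q <= Q ^ 2 by rewrite expnS expn1; nia.
case: C HC Hn HG => [|a C].
  by move=> _ _ _; eapply evs_le; [eapply evs_loop_abort; pop; halt | nia].
case/andP=> /orP[] /eqP -> HC Hn HG.
  by eapply evs_le; [eapply evs_loop_brk; pop; halt | nia].
rewrite /= in Hn HG *; have HB := @readB_ok C [::] R (flat es) [::] [::] [::] K A [::] HC.
case E: readB HB => [[B C2]|] /= HB; last first.
  by eapply evs_le; [eapply evs_loop_abort; pop; eapply evs_seq_abort; exact: HB | nia].
have [HBb HC2 HBs] := readB_spec E HC isT.
have HW : all trit (nt_str (rev B)).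
  by rewrite /= all_cat /= andbT all_rev; apply: sub_all HBb => b; rewrite /trit => ->.
set f := fuel es C2 (nt_str (rev B)).
have Hf : f <= Q.
  by rewrite /f /fuel /nt_str /= size_cat size_rev /= HQ; rewrite /= in HBs; nia.
have HR := @run_ok f es C2 (nt_str (rev B)) [::] R K A (rev B) HC2 Hes HW (leqnn _).
have HF : size (flat es) <= Q by rewrite HQ; nia.
have HRt : f * (60 * (f + size (flat es))) <= 120 * Q ^ 2.
  by apply: leq_trans (leq_mul Hf (leq_mul (leqnn 60) (leq_add Hf HF))) _; rewrite expnS expn1; nia.
have Hcom : forall o B2, evs (RUN ;; Push 3 4 ;; Push 3 3 ;; XFER 9 [:: 0] 0 ;; XFER 0 [:: 3] 0 ;; XFER 6 [::] 0)
   [:: [::]; C2; R; flat es; [::]; nt_str (rev B); [::]; K; A; rev B] o B2 ->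
   evs (Pop 1 Fail Break
    (READB ;; Push 5 3 ;; XFER 0 [:: 5; 9] 0 ;; Push 5 2 ;; RUN ;;
     Push 3 4 ;; Push 3 3 ;; XFER 9 [:: 0] 0 ;; XFER 0 [:: 3] 0 ;; XFER 6 [::] 0) Fail Fail)
   [:: [::]; 2 :: C; R; flat es; [::]; [::]; [::]; K; A; [::]] o (20 * Q + B2).
  move=> o B2 H; eapply evs_le.
    pop; eapply evs_seq; first exact: HB.
    eapply evs_seq; first push.
    eapply evs_seq; first by move_; rewrite bits_okay.
    eapply evs_seq; first push.
    exact: H.
  rewrite /= in HBs; clear -HBs HG HGQ.
  by rewrite /=; lia.
rewrite -/(runF es C2 (nt_str (rev B))) in HR.
case E2: runF HR => [[C3 ws]|] /= HR; last first.
  eapply evs_le; first by eapply evs_loop_abort, Hcom, evs_seq_abort; exact: HR.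
  by rewrite mulSn; clear -HRt HQQ; lia.
have [H1 H2 H3 H4] := run_spec Hes E2 HC2 HW isT.
have Hws : size (seen_str ws) <= Q by move: H4 Hf; rewrite /f /fuel /=; lia.
eapply evs_le.
  eapply evs_loop.
    eapply Hcom, evs_seq; first exact: HR.
    eapply evs_seq; first push.
    eapply evs_seq; first push.
    eapply evs_seq; first by move_; rewrite all_rev bits_okay.
    eapply evs_seq; first by move_; rewrite bits_okay.
    by move_; rewrite seen_okay.
  have := IH ((rev B, [::]) :: es) C3; rewrite flat_cons /=; apply=> //.
  - by rewrite /wfe /= all_rev HBb.
  - by rewrite /= in HBs; lia.
  - by rewrite size_cat /= size_rev; rewrite /= in HBs; lia.
rewrite -/Q mulSn size_rev /=; rewrite /= in HBs; clear -HRt HQQ HGQ Hws HBs HG; lia.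
Qed.

(** * Verifier: binary counters and parsing *)

Definition bitsN (x : N) : seq nat := if x is Npos p then bits_pos p else [::].
Definition bits (n : nat) : seq nat := bitsN (BinNat.N.of_nat n).

Lemma enc_natE n : enc_nat n = rcons (bits n) 3.
Proof. by rewrite /enc_nat /bits; case: BinNat.N.of_nat => //= p; rewrite cats1. Qed.

Lemma bits_pos_bit p : all bit (bits_pos p).
Proof. by elim: p. Qed.

Lemma bits_bit n : all bit (bits n).
Proof. by rewrite /bits; case: BinNat.N.of_nat => //= p; apply: bits_pos_bit. Qed.

Lemma bits_inj : injective bits.
Proof.
have Hp : injective bits_pos.
  elim=> [p IH|p IH|] [q|q|] //= [].
  - by move/IH->.
  - by case: p {IH}.
  - by move/IH->.
  - by case: q.
move=> a b; rewrite /bits => H; apply: Nnat.Nat2N.inj; move: H.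
case: BinNat.N.of_nat => [|p]; case: BinNat.N.of_nat => [|q] //=.
- by case: q.
- by case: p.
- by move/Hp->.
Qed.

Lemma size_bits_pos p : size (bits_pos p) <= BinPos.Pos.to_nat p.
Proof.
elim: p => //= p IH; rewrite ?Pnat.Pos2Nat.inj_xI ?Pnat.Pos2Nat.inj_xO;
  have := Pnat.Pos2Nat.is_pos p; lia.
Qed.

Lemma size_bits n : size (bits n) <= n.
Proof.
rewrite /bits -[X in _ <= X]Nnat.Nat2N.id; case: BinNat.N.of_nat => //= p.
exact: size_bits_pos.
Qed.

Lemma bitsS n : exists2 p, bits n.+1 = bits_pos p & bits n = bitsN (BinPos.Pos.pred_N p).
Proof.
exists (BinPos.Pos.of_succ_nat n) => //; rewrite /bits; congr bitsN.
by case: n => // n; rewrite /= BinPos.Pos.pred_N_succ.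
Qed.

(** Binary decrement, lowest bit on top, 1 standing for bit 0 and 2 for bit 1: low zeros become
    ones, and the first one becomes a zero, or vanishes if it was the highest bit. Thus no leading
    zero arises, zero remains the empty stack, and equal numbers have equal strings. *)
Definition DEC : cmd :=
  Loop (Pop 9 Fail (Push 0 2)
    (Pop 9 Skip (Push 9 1 ;; Push 9 1) (Push 9 2 ;; Push 9 1) Fail Fail ;; Break) Fail Fail) ;;
  XFER 0 [:: 9] 0.
(** To be used inside a loop, which it leaves when the counter is zero; otherwise the popped bit is
    put back. *)
Definition TEST : cmd := Pop 9 Break (Push 9 1) (Push 9 2) Fail Fail.

Lemma dec_loop p T C R L M W S K A : all bit T -> exists T' N',
  [/\ evs (Loop (Pop 9 Fail (Push 0 2)
    (Pop 9 Skip (Push 9 1 ;; Push 9 1) (Push 9 2 ;; Push 9 1) Fail Fail ;; Break) Fail Fail))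
    [:: T; C; R; L; M; W; S; K; A; bits_pos p] (Norm [:: T'; C; R; L; M; W; S; K; A; N'])
    (6 * size (bits_pos p)),
    rev T' ++ N' = rev T ++ bitsN (BinPos.Pos.pred_N p), all bit T' &
    size T' <= size T + size (bits_pos p)].
Proof.
elim: p T => [p _|p IH|] T HT.
- exists T, (1 :: bits_pos p); split=> //; last lia.
  have [|[q Eq]] : p = xH \/ exists q, bits_pos p = 1 :: q \/ bits_pos p = 2 :: q.
  + by case: p => [p|p|]; [right; exists (bits_pos p); right | right; exists (bits_pos p); left | left].
  + move=> ->; eapply evs_le.
      by eapply evs_loop_brk; pop; eapply evs_seq; [pop; eapply evs_seq; push | halt].
    by [].
  + by case: Eq => Eq; eapply evs_le; [rewrite /= Eq;
      eapply evs_loop_brk; pop; eapply evs_seq; [pop; eapply evs_seq; push | halt] |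
      rewrite /= Eq /=; lia |  rewrite /= Eq;
      eapply evs_loop_brk; pop; eapply evs_seq; [pop; eapply evs_seq; push | halt] |
      rewrite /= Eq /=; lia].
- have [T' [N' [H1 H2 H3 H4]]] := IH (2 :: T) HT.
  exists T', N'; split=> //.
  + eapply evs_le; first by eapply evs_loop; [pop; push | exact: H1].
    by rewrite /=; lia.
  + by rewrite H2 rev_cons cat_rcons; congr (_ ++ _) => {IH H1 H2 H4}; case: p.
  + by rewrite /= in H4 *; lia.
- exists T, [::]; split=> //; last by rewrite /=; lia.
  by eapply evs_le; [eapply evs_loop_brk; pop; eapply evs_seq; [pop; halt | halt] |].
Qed.

Lemma dec_ok n C R L M W S K A :
  evs DEC [:: [::]; C; R; L; M; W; S; K; A; bits n.+1]
    (Norm [:: [::]; C; R; L; M; W; S; K; A; bits n]) (10 * n.+2).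
Proof.
have [p Ep En] := bitsS n.
have [T' [N' [H1 H2 H3 H4]]] := @dec_loop p [::] C R L M W S K A isT.
eapply evs_le.
  rewrite Ep; eapply evs_seq; first exact: H1.
  eapply evs_move; [by [] | by [] | lit | by rewrite bits_okay |].
  by rewrite /= H2 -En.
by have := size_bits n.+1; rewrite Ep /= in H4 *; lia.
Qed.

Lemma test_ok n T C R L M W S K A :
  evs TEST [:: T; C; R; L; M; W; S; K; A; bits n.+1]
    (Norm [:: T; C; R; L; M; W; S; K; A; bits n.+1]) 2.
Proof.
have [p -> _] := bitsS n.
by case: p => [p|p|]; eapply evs_le; [pop; push | | pop; push | | pop; push |].
Qed.

(** Here [es] consists of rules [a -> eps] for the letters seen, so expanding the name of [k']
    succeeds only if that letter occurred. Letters are checked from the largest down, which suits a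
    decrementing counter. *)
Fixpoint lookup_all (es : seq entry) (k : nat) (C : seq nat) : bool :=
  if k is k'.+1 then
    if expand es C (rcons (bits k') 3) is Some (C', _) then lookup_all es k' C' else false
  else true.

Definition LOOKUP : cmd :=
  Loop (TEST ;; DEC ;; Push 5 3 ;; XFER 9 [:: 0] 0 ;; XFER 0 [:: 9; 5] 0 ;; EXPAND).

Lemma lookup_ok es k C R S K A : all bit C -> all wfe es -> all (fun e => e.2 == [::]) es ->
  exists2 o, evs LOOKUP [:: [::]; C; R; flat es; [::]; [::]; S; K; A; bits k] o
    (k.+1 * (100 * (size C + size (flat es) + k).+1)) &
    if lookup_all es k C then exists m, o = Norm m else o = Abort.
Proof.
move=> + Hes Hnil; elim: k C => [|k IH] C HC.
  eexists; last by eexists.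
  by eapply evs_le; [eapply evs_loop_brk, evs_seq_brk; pop; halt | lia].
have HE := @expand_ok C es R (rcons (bits k) 3) S K A (bits k) HC Hes.
have Hpre : forall o B2, evs EXPAND [:: [::]; C; R; flat es; [::]; rcons (bits k) 3; S; K; A; bits k] o B2 ->
   evs (TEST ;; DEC ;; Push 5 3 ;; XFER 9 [:: 0] 0 ;; XFER 0 [:: 9; 5] 0 ;; EXPAND)
    [:: [::]; C; R; flat es; [::]; [::]; S; K; A; bits k.+1] o (30 * k.+2 + B2).
  move=> o B2 H; eapply evs_le.
    eapply evs_seq; first exact: test_ok.
    eapply evs_seq; first exact: dec_ok.
    eapply evs_seq; first push.
    eapply evs_seq; first by move_; rewrite bits_okay ?bits_bit.
    eapply evs_seq; first by move_; rewrite all_rev bits_okay ?bits_bit.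
    by rewrite -cats1 in H; exact: H.
  by have := size_bits k; rewrite /= ?size_rev; lia.
rewrite /=; case E: expand HE => [[C' W']|] /= HE; last first.
  by exists Abort => //; eapply evs_le; [eapply evs_loop_abort, Hpre; exact: HE | nia].
have [[u [rhs [W2 [Hin EW EW']]]] HsC /(_ HC) HC'] := expand_spec E.
have /eqP /= Hr := allP Hnil _ Hin.
have EW2 : W' = [::].
  rewrite EW' Hr /=; move: EW; case/lastP: W2 {EW'} => // W2 a.
  rewrite -cat_rcons -rcons_cat => /eqP; rewrite eqseq_rcons => /andP[/eqP Hb _].
  by have := bits_bit k; rewrite Hb all_cat all_rcons.
have [o Ho1 Ho2] := IH C' HC'; exists o => //.
rewrite EW2 in HE; eapply evs_le; first by eapply evs_loop; [apply: Hpre; exact: HE | exact: Ho1].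
set X := size (flat es); rewrite -/X in Ho1 HE *.
have H : k.+1 * (100 * (size C' + X + k).+1) <= k.+1 * (100 * (size C + X + k.+1).+1).
  by rewrite leq_mul2l leq_mul2l; apply/orP; right; apply/orP; right; lia.
by rewrite [k.+2 * _]mulSn; lia.
Qed.

Definition enc_rhs (rhs : seq symb) : seq nat := flatten (map enc_symb rhs).
Definition enc_entry (r : nat * seq symb) : entry := (bits r.1, enc_rhs r.2).

Lemma enc_rhs_cons s rhs : enc_rhs (s :: rhs) = enc_symb s ++ enc_rhs rhs. Proof. by []. Qed.

Lemma enc_symbE s : exists b n, enc_symb s = b :: rcons (bits n) 3 /\ bit b.
Proof. by case: s => n; rewrite /= enc_natE; [exists 1|exists 2]; exists n. Qed.

Lemma enc_rhs_trit rhs : all trit (enc_rhs rhs).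
Proof.
elim: rhs => //= s rhs IH; rewrite enc_rhs_cons all_cat IH andbT.
have [b [n [-> Hb]]] := enc_symbE s; rewrite /= all_rcons /= /trit Hb /=.
by apply: sub_all (bits_bit n) => a ->.
Qed.

Lemma enc_entry_wf r : wfe (enc_entry r).
Proof. by rewrite /wfe /= bits_bit enc_rhs_trit. Qed.

Lemma enc_entries_wf rs : all wfe (map enc_entry rs).
Proof. by elim: rs => //= r rs IH; rewrite enc_entry_wf. Qed.

Definition PARSE_SYMBOLS : cmd := Loop (TEST ;; DEC ;; XFER 2 [:: 4] 3 ;; Push 4 3).

Lemma parse_symbols_ok rhs R C L M W S K A :
  evs PARSE_SYMBOLS [:: [::]; C; enc_rhs rhs ++ R; L; M; W; S; K; A; bits (size rhs)]
    (Norm [:: [::]; C; R; L; rev (enc_rhs rhs) ++ M; W; S; K; A; [::]])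
    ((size rhs).+1 * (30 * (size (enc_rhs rhs) + size rhs).+1)).
Proof.
elim: rhs M => [|s rhs IH] M.
  by eapply evs_le; [eapply evs_loop_brk, evs_seq_brk; pop; halt|].
rewrite enc_rhs_cons -catA [size (s :: rhs)]/=; have [b [n [-> Hb]]] := enc_symbE s.
eapply evs_le.
  eapply evs_loop.
    eapply evs_seq; first exact: test_ok.
    eapply evs_seq; first exact: dec_ok.
    eapply evs_seq; last push.
    until_ (b :: bits n) (enc_rhs rhs ++ R); first by rewrite /stk /= cat_rcons.
    by rewrite bits_okay //= Hb bits_bit.
  have := IH (3 :: rev (b :: bits n) ++ M).
  rewrite (_ : rev (enc_rhs rhs) ++ 3 :: rev (b :: bits n) ++ M
     = rev ((b :: rcons (bits n) 3) ++ enc_rhs rhs) ++ M); first by apply.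
  by rewrite -rcons_cons rev_cat rev_rcons -catA.
have := size_bits n; rewrite /= size_cat /= size_rcons [(_).+2 * _]mulSn.
set r := size rhs; set X := size (enc_rhs rhs) => _.
have : r.+1 * (30 * (X + r).+1) <= r.+1 * (30 * ((size (bits n)).+2 + X + r.+1).+1).
  by rewrite leq_mul2l leq_mul2l; apply/orP; right; apply/orP; right; lia.
by rewrite addSn; lia.
Qed.

(** An instance gives the length of a right side in binary before it, whereas the rule list marks
    its end by 4; hence the counted inner loop. The initial [Pop] only peeks whether a rule is
    left. *)
Definition PARSE_RULES : cmd :=
  Loop (Pop 2 Break (Push 2 1) (Push 2 2) (Push 2 3) Fail ;;
    XFER 2 [:: 4] 3 ;; Push 4 3 ;; XFER 2 [:: 0] 3 ;; XFER 0 [:: 9] 0 ;;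
    PARSE_SYMBOLS ;; Push 4 4).

Lemma enc_ruleE r : enc_rule r =
  rcons (bits r.1) 3 ++ rcons (bits (size r.2)) 3 ++ enc_rhs r.2.
Proof. by rewrite /enc_rule !enc_natE. Qed.

Lemma size_enc_rhs rhs : size rhs <= size (enc_rhs rhs).
Proof.
elim: rhs => //= s rhs IH; rewrite enc_rhs_cons size_cat.
by have [b [n [-> _]]] := enc_symbE s; rewrite /= size_rcons; lia.
Qed.

Lemma parse_rules_ok rs C L M W S K A X : size (flatten (map enc_rule rs)) <= X ->
  evs PARSE_RULES [:: [::]; C; flatten (map enc_rule rs); L; M; W; S; K; A; [::]]
    (Norm [:: [::]; C; [::]; L; rev (flat (map enc_entry rs)) ++ M; W; S; K; A; [::]])
    ((size rs).+1 * (100 * X.+1 ^ 2)).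
Proof.
elim: rs M => [|r rs IH] M HX.
  by eapply evs_le; [eapply evs_loop_brk, evs_seq_brk; pop; halt|rewrite expnS expn1; nia].
rewrite /= in HX *; move: HX.
set R := flatten _; rewrite -/R in IH; rewrite size_cat enc_ruleE => HX.
eapply evs_le.
  eapply evs_loop.
    eapply (@evs_seq _ _ _
      [:: [::]; C; (rcons (bits r.1) 3 ++ rcons (bits (size r.2)) 3 ++ enc_rhs r.2) ++ R;
          L; M; W; S; K; A; [::]] _ 2).
      case: (bits r.1) (bits_bit r.1) => [_|a u]; first by pop; push.
      by case/andP=> /orP[] /eqP -> _; pop; push.
    eapply evs_seq.
      until_ (bits r.1) (rcons (bits (size r.2)) 3 ++ enc_rhs r.2 ++ R).
        by rewrite /stk /= -!catA cat_rcons.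
      by rewrite bits_okay ?bits_bit.
    eapply evs_seq; first push.
    eapply evs_seq.
      until_ (bits (size r.2)) (enc_rhs r.2 ++ R); first by rewrite /stk /= cat_rcons.
      by rewrite bits_okay ?bits_bit.
    eapply evs_seq; first by move_; rewrite all_rev bits_okay ?bits_bit.
    eapply evs_seq; first exact: parse_symbols_ok.
    push.
  have := IH (4 :: rev (enc_rhs r.2) ++ 3 :: rev (bits r.1) ++ M).
  rewrite flat_cons /= (_ : rev (flat (map enc_entry rs)) ++ 4 :: _
     = rev (bits r.1 ++ 3 :: enc_rhs r.2 ++ 4 :: flat (map enc_entry rs)) ++ M).
    by apply; lia.
  by rewrite !(rev_cat, rev_cons) /= -!cats1 -!catA.
rewrite !size_cat !size_rcons in HX; have := size_enc_rhs r.2.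
move: HX; rewrite [(_).+2 * _]mulSn size_rev /=.
set a := size (bits _); set b := size (bits _); set n := size r.2; set x := size (enc_rhs _).
move=> HX Hn.
have : n.+1 * (30 * (x + n).+1) <= X.+1 * (30 * (2 * X.+1)) by apply: leq_mul; lia.
have HX2 : X.+1 ^ 2 = X.+1 * X.+1 by rewrite expnS expn1.
have : X.+1 <= X.+1 ^ 2 by rewrite HX2; nia.
by rewrite HX2; lia.
Qed.

(** * Verifier: the whole program *)

Lemma blocks_spec n es C C' es' : blocks n es C = Some (C', es') ->
  all bit C -> all wfe es ->
  [/\ all bit C', all wfe es' & size C' + size (flat es') <= size C + size (flat es)].
Proof.
elim: n es C => // n IH es [|[|[|[|a]]] C] //=.
  by case=> <- <- HC Hes; split=> //; lia.
case E: readB => [[B C2]|] //; case E2: runF => [[C3 ws]|] // H HC Hes.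
have [HBb HC2 HBs] := readB_spec E HC isT.
have HW : all trit (nt_str (rev B)).
  by rewrite /= all_cat /= andbT all_rev; apply: sub_all HBb => b; rewrite /trit => ->.
have [H1 H2 H3 H4] := run_spec Hes E2 HC2 HW isT.
have [||H5 H6 H7] := IH _ _ H; rewrite //= ?[wfe _]/wfe /= ?all_rev ?HBb //.
split=> //; move: H7; rewrite flat_cons /= size_cat /= size_rev; rewrite /= in HBs; lia.
Qed.

Definition final_entries (ws : seq (seq nat)) : seq entry := [seq (u, [::]) | u <- rev ws].

Lemma rev_seen_str ws : rev (seen_str ws) = flat (final_entries ws).
Proof.
elim: ws => // u ws IH; rewrite /final_entries rev_cons map_rcons -cats1 flat_cat -IH flat_cons.
by rewrite {1}/seen_str /= -/(seen_str ws) !rev_cons rev_cat revK -!cats1 -!catA.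
Qed.

Definition verify (k s : nat) (es : seq entry) (C : seq nat) : bool :=
  if blocks (size C).+1 es C is Some (C1, es1) then
    if runF es1 C1 (nt_str (bits s)) is Some (C2, ws) then lookup_all (final_entries ws) k C2
    else false
  else false.

(** The input lies reversed on stack 0, so the certificate comes off first. Each transfer reverses:
    [k] takes two of them, and the start symbol stays reversed until [FINISH] moves it again. *)
Definition HEADER : cmd :=
  XFER 0 [:: 1] 4 ;; XFER 0 [:: 2] 0 ;; XFER 2 [:: 0] 3 ;; XFER 0 [:: 7] 0 ;;
  XFER 2 [::] 3 ;; XFER 2 [:: 8] 3 ;; XFER 2 [::] 3.
Definition FINISH : cmd :=
  Push 5 3 ;; XFER 8 [:: 5] 0 ;; Push 5 2 ;; RUN ;;
  XFER 3 [::] 0 ;; XFER 6 [:: 3] 0 ;; XFER 7 [:: 0] 0 ;; XFER 0 [:: 9] 0 ;; LOOKUP.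
Definition MAIN : cmd := HEADER ;; PARSE_RULES ;; XFER 4 [:: 3] 0 ;; BLOCKS ;; FINISH.

Lemma enc_instE k G : enc_inst (k, G) =
  rcons (bits k) 3 ++ rcons (bits (nnt G)) 3 ++ rcons (bits (start G)) 3 ++
  rcons (bits (size (rules G))) 3 ++ flatten (map enc_rule (rules G)).
Proof. by rewrite /enc_inst !enc_natE. Qed.

Lemma flat_okay es : all wfe es -> all (okay 0) (flat es).
Proof.
elim: es => //= e es IH /andP[/andP[H1 H2] /IH H].
by rewrite flat_cons all_cat /= bits_okay //= all_cat trits_okay //= H.
Qed.

Lemma enc_rules_okay rs : all (okay 0) (flatten (map enc_rule rs)).
Proof.
elim: rs => //= r rs IH; rewrite enc_ruleE !all_cat IH !all_rcons /=.
by rewrite (trits_okay (enc_rhs_trit _)) // !bits_okay ?bits_bit.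
Qed.

Lemma enc_inst_okay k G : all (okay 0) (enc_inst (k, G)).
Proof.
by rewrite enc_instE !(all_cat, all_rcons) enc_rules_okay !bits_okay ?bits_bit.
Qed.

Lemma header_ok k G C : all bit C ->
  evs HEADER (start_mem (enc_inst (k, G) ++ 4 :: C))
    (Norm [:: [::]; C; flatten (map enc_rule (rules G)); [::]; [::]; [::]; [::];
       bits k; rev (bits (start G)); [::]])
    (20 * (size (enc_inst (k, G)) + size C).+1).
Proof.
move=> HC; set x := enc_inst _.
have Ex := enc_instE k G; rewrite -/x in Ex.
eapply evs_le.
  rewrite /start_mem rev_cat rev_cons cat_rcons /=.
  eapply evs_seq; first by until_ (rev C) (rev x); rewrite ?all_rev ?bits_okay.
  eapply evs_seq; first by move_; rewrite all_rev enc_inst_okay.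
  rewrite Ex.
  eapply evs_seq.
    until_ (bits k) (rcons (bits (nnt G)) 3 ++ rcons (bits (start G)) 3 ++
      rcons (bits (size (rules G))) 3 ++ flatten (map enc_rule (rules G))).
      by rewrite /stk /= cat_rcons.
    by rewrite bits_okay ?bits_bit.
  eapply evs_seq; first by move_; rewrite all_rev bits_okay ?bits_bit.
  eapply evs_seq.
    until_ (bits (nnt G)) (rcons (bits (start G)) 3 ++
      rcons (bits (size (rules G))) 3 ++ flatten (map enc_rule (rules G))).
      by rewrite /stk /= cat_rcons.
    by rewrite bits_okay ?bits_bit.
  eapply evs_seq.
    until_ (bits (start G)) (rcons (bits (size (rules G))) 3 ++ flatten (map enc_rule (rules G))).
      by rewrite /stk /= cat_rcons.
    by rewrite bits_okay ?bits_bit.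
  until_ (bits (size (rules G))) (flatten (map enc_rule (rules G))).
    by rewrite /stk /= cat_rcons.
  by rewrite bits_okay ?bits_bit.
have := congr1 size Ex; rewrite !(size_cat, size_rcons, size_rev) /=; lia.
Qed.

Lemma finish_ok k s es C Z : all bit C -> all wfe es ->
  size C + size (flat es) + k + s <= Z ->
  exists2 o, evs FINISH
    [:: [::]; C; [::]; flat es; [::]; [::]; [::]; bits k; rev (bits s); [::]] o
    (500 * ((Z + 2) ^ 2) ^ 2) &
    if (if runF es C (nt_str (bits s)) is Some (C2, ws) then lookup_all (final_entries ws) k C2
        else false) then exists m, o = Norm m else o = Abort.
Proof.
set Q := (Z + 2) ^ 2; have HQ : Q = (Z + 2) * (Z + 2) by rewrite /Q expnS expn1.
have HQ2 : Q ^ 2 = Q * Q by rewrite expnS expn1.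
move=> HC Hes HZ; have Hs := size_bits s; have Hk := size_bits k.
have HGQ : Z + 2 <= Q by rewrite HQ; nia.
have HQQ : Q <= Q ^ 2 by rewrite HQ2; nia.
have HW : all trit (nt_str (bits s)).
  by rewrite /= all_cat /= andbT; apply: sub_all (bits_bit s) => b; rewrite /trit => ->.
set f := fuel es C (nt_str (bits s)).
have Hf : f <= Q by rewrite /f /fuel /nt_str /= size_cat /= HQ; nia.
have HF : size (flat es) <= Q by lia.
have HR := @run_ok f es C (nt_str (bits s)) [::] [::] (bits k) [::] [::] HC Hes HW (leqnn _).
have HRt : f * (60 * (f + size (flat es))) <= 120 * Q ^ 2.
  by apply: leq_trans (leq_mul Hf (leq_mul (leqnn 60) (leq_add Hf HF))) _; rewrite HQ2; nia.
have Hpre : forall o B2, evs (RUN ;; XFER 3 [::] 0 ;; XFER 6 [:: 3] 0 ;; XFER 7 [:: 0] 0 ;;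
    XFER 0 [:: 9] 0 ;; LOOKUP)
   [:: [::]; C; [::]; flat es; [::]; nt_str (bits s); [::]; bits k; [::]; [::]] o B2 ->
   evs FINISH [:: [::]; C; [::]; flat es; [::]; [::]; [::]; bits k; rev (bits s); [::]] o
    (10 * Q + B2).
  move=> o B2 H; eapply evs_le.
    eapply evs_seq; first push.
    eapply evs_seq; first by move_; rewrite all_rev bits_okay ?bits_bit.
    eapply evs_seq; first push.
    exact: H.
  by rewrite /= size_rev; clear -Hs HZ HGQ; lia.
rewrite -/(runF es C (nt_str (bits s))) in HR.
case E: runF HR => [[C2 ws]|] /= HR; last first.
  exists Abort => //; eapply evs_le; first by eapply Hpre, evs_seq_abort; exact: HR.
  by clear -HRt HQQ; lia.
have [H1 H2 H3 H4] := run_spec Hes E HC HW isT.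
have Hws : size (seen_str ws) <= Q by move: H4 Hf; rewrite /f /fuel /=; lia.
have Hfw : all wfe (final_entries ws).
  by rewrite all_map all_rev; apply: sub_all H3 => u Hu; rewrite /= /wfe Hu.
have Hfn : all (fun e : entry => e.2 == [::]) (final_entries ws) by rewrite all_map; apply/allP.
have [o Ho1 Ho2] := @lookup_ok (final_entries ws) k C2 [::] [::] [::] [::] H2 Hfw Hfn.
exists o => //; eapply evs_le.
  eapply Hpre, evs_seq; first exact: HR.
  eapply evs_seq; first by move_; rewrite flat_okay.
  eapply evs_seq; first by move_; rewrite seen_okay.
  eapply evs_seq; first by move_; rewrite bits_okay ?bits_bit.
  eapply evs_seq; first by move_; rewrite all_rev bits_okay ?bits_bit.
  by rewrite rev_seen_str; exact: Ho1.
rewrite -rev_seen_str !size_rev /=.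
have : k.+1 * (100 * (size C2 + size (seen_str ws) + k).+1) <= Q * (100 * (2 * Q)).
  by apply: leq_mul; [|rewrite leq_mul2l /=]; clear -H1 Hws HZ HGQ; lia.
by clear -HRt HQ2 Hws HF HQQ HGQ HZ Hk; lia.
Qed.

(** The fifth power is due to [BLOCKS], with at most [size C + 1] rounds of quartic cost; parsing is
    cubic and [FINISH] quartic in [Z + 2]. *)
Lemma main_ok k G C Z : all bit C ->
  size (enc_inst (k, G)) + size C + size (rules G) + k + start G <= Z ->
  exists2 o, evs MAIN (start_mem (enc_inst (k, G) ++ 4 :: C)) o (1000 * (Z + 2) ^ 5) &
    if verify k (start G) (map enc_entry (rules G)) C then exists m, o = Norm m else o = Abort.
Proof.
move=> HC HZ; set es := map enc_entry (rules G); set x := flatten (map enc_rule (rules G)).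
have Hes : all wfe es := enc_entries_wf _.
have Hx : size (flat es) <= size x.
  rewrite /es /x; elim: (rules G) => //= r rs IH.
  by rewrite flat_cons enc_ruleE !(size_cat, size_rcons) /= size_cat /=; lia.
have Hx2 : size x <= size (enc_inst (k, G)) by rewrite enc_instE !size_cat -/x; lia.
have HB := @blocks_ok (size C).+1 es C [::] (bits k) (rev (bits (start G))) Z HC Hes (leqnn _).
set Q := Z + 2 in HB *; have HQZ : Q = Z + 2 by []; move: Q HQZ HB => Q HQZ HB.
have E5 : Q ^ 5 = Q * (Q ^ 2) ^ 2 by rewrite -expnM -expnS.
have HQ2 : Q <= Q ^ 2 by rewrite expnS expn1; nia.
have HQ4 : Q ^ 2 <= (Q ^ 2) ^ 2 by rewrite [(Q ^ 2) ^ 2]expnS expn1; nia.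
have Q2 : 2 <= Q by lia.
have Hpre : forall o B2, evs (BLOCKS ;; FINISH)
    [:: [::]; C; [::]; flat es; [::]; [::]; [::]; bits k; rev (bits (start G)); [::]] o B2 ->
    evs MAIN (start_mem (enc_inst (k, G) ++ 4 :: C)) o (200 * Q ^ 5 + B2).
  move=> o B2 H; eapply evs_le.
    eapply evs_seq; first exact: header_ok.
    eapply evs_seq; first by apply: (@parse_rules_ok _ _ _ _ _ _ _ _ Z); rewrite -/x; lia.
    eapply evs_seq; first by move_; rewrite all_rev flat_okay.
    exact: H.
  rewrite size_rev.
  have : (size (rules G)).+1 * (100 * Z.+1 ^ 2) <= Q * (100 * Q ^ 2).
    by apply: leq_mul; rewrite ?leq_mul2l ?leq_exp2r //; lia.
  have : Q * (100 * Q ^ 2) <= 100 * Q ^ 5 by rewrite E5; nia.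
  have : Q ^ 2 <= Q ^ 5 by rewrite E5; nia.
  by clear -HZ Hx Hx2 HQ2 HQZ; rewrite -/es; move: (enc_inst _) HZ Hx2 => y HZ Hx2 /=; lia.
have HBt : (size C).+1 * (200 * (Q ^ 2) ^ 2) <= 200 * Q ^ 5.
  rewrite E5 mulnCA leq_mul2l /= leq_mul2r; apply/orP; right; lia.
rewrite /verify; case E: blocks HB => [[C1 es1]|] /= HB; last first.
  exists Abort => //; eapply evs_le; first by eapply Hpre, evs_seq_abort, HB; lia.
  by clear -HBt; lia.
have [H1 H2 H3] := blocks_spec E HC Hes.
have [|o Ho1 Ho2] := @finish_ok k (start G) es1 C1 Z H1 H2; first lia.
exists o => //; eapply evs_le; first by eapply Hpre, evs_seq; [apply: HB; lia | exact: Ho1].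
rewrite -HQZ; have : 500 * (Q ^ 2) ^ 2 <= 250 * Q ^ 5 by rewrite E5; nia.
by clear -HBt; lia.
Qed.

(** * Soundness of the verifier *)

Notation crule := (nat * seq symb)%type.

(* [lderives E al js w]: the sentential form [al] derives [w] leftmost, and [js] lists the positions
   in [E] of the rules used. *)
Inductive lderives (E : seq crule) : seq symb -> seq nat -> seq nat -> Prop :=
| ld_nil : lderives E [::] [::] [::]
| ld_T a al js w : lderives E al js w -> lderives E (T a :: al) js (a :: w)
| ld_NT E1 r E2 al js w : E = E1 ++ r :: E2 -> lderives E (r.2 ++ al) js w ->
    lderives E (NT r.1 :: al) (size E1 :: js) w.

Lemma lderives_cat E al js w be ks v :
  lderives E al js w -> lderives E be ks v -> lderives E (al ++ be) (js ++ ks) (w ++ v).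
Proof.
move=> H Hb; elim: H => {al js w} [|a al js w _ IH|E1 r E2 al js w HE _ IH] //=.
  exact: ld_T.
by apply: ld_NT HE _; rewrite catA.
Qed.

Lemma lderives_lt E al js w : lderives E al js w -> all (fun j => j < size E) js.
Proof.
elim=> //= E1 r E2 al' js' w' -> _ ->; rewrite andbT size_cat /=; lia.
Qed.

Lemma lderives_size E al js w X : all (fun r : crule => size r.2 <= X) E ->
  lderives E al js w -> size w <= size al + size js * X.
Proof.
move=> HX; elim=> //= E1 r E2 al' js' w' HE _.
have : size r.2 <= X by move: HX; rewrite HE all_cat /= => /and3P[].
by rewrite size_cat mulSn; lia.
Qed.

Lemma In_split_cat (U : Type) (x : U) s : List.In x s -> exists s1 s2, s = s1 ++ x :: s2.
Proof. exact: List.in_split. Qed.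

Lemma In_cat (U : Type) (x : U) s1 s2 : List.In x (s1 ++ x :: s2).
Proof. by apply: List.in_or_app; right; left. Qed.

Lemma mem_map_split (U : Type) (V : eqType) (f : U -> V) y s : y \in map f s ->
  exists s1 x s2, s = s1 ++ x :: s2 /\ y = f x.
Proof.
elim: s => //= x s IH; rewrite inE => /orP[/eqP ->|/IH [s1 [x' [s2 [-> ->]]]]].
  by exists [::], x, s.
by exists (x :: s1), x', s2.
Qed.

Lemma bit3_inj u v X Y : all bit u -> all bit v -> u ++ 3 :: X = v ++ 3 :: Y -> u = v /\ X = Y.
Proof.
elim: u v => [|a u IH] [|b v] //=.
- by move=> _ _ [].
- by move=> _ /andP[Hb _] [E _]; rewrite -E in Hb.
- by move=> /andP[Ha _] _ [E _]; rewrite E in Ha.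
- by move=> /andP[_ Hu] /andP[_ Hv] [-> /(IH _ Hu Hv)[-> ->]].
Qed.

Lemma index3_bits a X : index 3 (bits a ++ 3 :: X) = size (bits a).
Proof.
have H : 3 \notin bits a by apply/negP => /(allP (bits_bit a)).
by rewrite index_cat (negbTE H) /= addn0.
Qed.

Lemma run_sound E n C al ws C' ws' :
  run n (map enc_entry E) C (enc_rhs al) ws = Some (C', ws') ->
  exists js w, lderives E al js w /\ ws' = rev (map bits w) ++ ws.
Proof.
elim: n C al ws => // n IH C [|s al] ws.
  by case=> _ <-; exists [::], [::]; split=> //; apply: ld_nil.
rewrite enc_rhs_cons; case: s => a.
  rewrite /enc_symb enc_natE cat_cons cat_rcons /= index3_bits mem_cat inE eqxx orbT.
  rewrite take_size_cat // -cat_rcons drop_size_cat ?size_rcons //.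
  case/IH=> js [w [H1 H2]]; exists js, (a :: w); split; first exact: ld_T.
  by rewrite H2 /= rev_cons cat_rcons.
rewrite /enc_symb enc_natE cat_cons /=.
case Ee: expand => [[C1 W1]|] // Hr.
have [[u [rhs [W2 [Hin EW EW']]]] _ _] := expand_spec Ee.
have [E1 [r [E2 [HE [Eu Er]]]]] := mem_map_split Hin.
move: EW; rewrite cat_rcons Eu => /bit3_inj [||/bits_inj Ea EX]; rewrite ?bits_bit //.
move: Hr; rewrite EW' Er -EX /enc_rhs -flatten_cat -map_cat -/(enc_rhs _).
case/IH=> js [w [H1 H2]]; exists (size E1 :: js), w; split=> //.
by rewrite Ea; apply: ld_NT HE H1.
Qed.

(** A certificate may name a nonterminal by a bit string that is not the encoding of a number. A
    successful run starts by matching this string with the left side of a rule, which is such an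
    encoding. *)
Lemma run_nt_bits E n C u ws x : all bit u -> run n (map enc_entry E) C (nt_str u) ws = Some x ->
  exists b, u = bits b.
Proof.
move=> Hu; case: n => // n /=; case Ee: expand => [[C1 W1]|] // _.
have [[v [rhs [W2 [Hin EW _]]]] _ _] := expand_spec Ee.
have [E1 [r [E2 [_ [Ev _]]]]] := mem_map_split Hin.
by exists r.1; move: EW; rewrite Ev => /bit3_inj [] //; apply: bits_bit.
Qed.

Lemma nt_strE b : nt_str (bits b) = enc_rhs [:: NT b].
Proof. by rewrite enc_rhs_cons /= enc_natE /enc_rhs /= cats0 -cats1. Qed.

Scheme derives_mind := Minimality for derives Sort Prop
  with derives_seq_mind := Minimality for derives_seq Sort Prop.
Combined Scheme derives_both from derives_mind, derives_seq_mind.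

Lemma derives_seq_catP G al be w : derives_seq G (al ++ be) w ->
  exists u v, [/\ w = u ++ v, derives_seq G al u & derives_seq G be v].
Proof.
elim: al w => [|s al IH] w /= H; first by exists [::], w; split=> //; apply: dseq_nil.
move Ea: (s :: al ++ be) H => ga H; case: H Ea => [//|a rest v Hr|B rest u v HB Hr] [Es Er]; subst.
  have [u1 [v1 [-> H1 H2]]] := IH _ Hr.
  by exists (a :: u1), v1; split=> //; apply: dseq_T.
have [u1 [v1 [-> H1 H2]]] := IH _ Hr.
by exists (u ++ u1), v1; split=> //; rewrite ?catA //; apply: dseq_NT.
Qed.

Section Grammar.
Variables (k : nat) (G : cfg).
Hypothesis wfG : wf_cfg k G.

Definition productive (b : nat) : Prop := exists w, derives G b w.

Definition sound_rule (r : crule) : Prop :=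
  List.In r (rules G) \/ r.2 = [::] /\ productive r.1.

Lemma lderives_sound E al js w : (forall r, List.In r E -> sound_rule r) ->
  lderives E al js w -> exists2 w', derives_seq G al w' & {subset w <= w'}.
Proof.
move=> HE; elim=> {al js w} [|a al js w _ [w' H1 H2]|E1 r E2 al js w Er _ [w' H1 H2]].
- by exists [::] => //; apply: dseq_nil.
- exists (a :: w'); first exact: dseq_T.
  by move=> x; rewrite !inE => /orP[->|/H2->] //; rewrite orbT.
- have := HE r; rewrite Er => /(_ (In_cat _ _ _)) [Hr|[Hr [u Hu]]].
    have [u [v [Ew Hu Hv]]] := derives_seq_catP H1.
    exists w' => //; rewrite Ew; apply: dseq_NT Hv.
    by apply: derives_rule Hu; case: (r) Hr.
  exists (u ++ w'); first by apply: dseq_NT Hu _; rewrite Hr in H1.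
  by move=> x /H2 Hx; rewrite mem_cat Hx orbT.
Qed.

Lemma derives_seq_NT1 b w : derives_seq G [:: NT b] w -> derives G b w.
Proof.
move Ea: [:: NT b] => al H; case: H Ea => // B rest u v HB Hr [-> Er].
case: Hr Er => // _; by rewrite cats0.
Qed.

Lemma blocks_sound n E C C' es' : (forall r, List.In r E -> sound_rule r) -> all bit C ->
  blocks n (map enc_entry E) C = Some (C', es') ->
  exists2 E', es' = map enc_entry E' & forall r, List.In r E' -> sound_rule r.
Proof.
elim: n E C => // n IH E [|[|[|[|a]]] C] HE //=.
  by move=> _ [_ <-]; exists E.
case Eb: readB => [[B C2]|] //; case E2: runF => [[C3 ws]|] // HC.
have [HB HC2 _] := readB_spec Eb HC isT.
have [|b Hb] := run_nt_bits _ E2; first by rewrite all_rev.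
move: E2; rewrite Hb nt_strE => E2.
have [js [w [/(lderives_sound HE) [w' H1 _] _]]] := run_sound E2.
apply: (IH ((b, [::]) :: E)); last first.
  have [_ HC3 _ _] := run_spec (enc_entries_wf _) E2 HC2 (enc_rhs_trit _) isT; exact: HC3.
by move=> r [<-|/HE] //; right; split=> //; exists w'; apply: derives_seq_NT1.
Qed.

Lemma lookup_all_sound es j C : lookup_all es j C ->
  (forall e, e \in es -> all bit e.1) -> forall a, a < j -> exists2 e, e \in es & e.1 = bits a.
Proof.
move=> + Hes; elim: j C => // j IH C /=.
case E: expand => [[C1 W1]|] // /IH H a; rewrite ltnS leq_eqVlt => /orP[/eqP ->|/H] //.
have [[u [rhs [W2 [Hin EW _]]]] _ _] := expand_spec E.
exists (u, rhs) => //=; move: EW; rewrite -cats1 => /bit3_inj [] //; first exact: bits_bit.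
exact: Hes Hin.
Qed.

Lemma derives_wf :
  (forall A w, derives G A w -> all (fun a => a < k) w) /\
  (forall al w, derives_seq G al w -> all (wf_symb k (nnt G)) al -> all (fun a => a < k) w).
Proof.
apply: derives_both => //.
- by move=> A rhs w Hr _ IH; apply: IH; have [_ /(_ _ _ Hr) []] := wfG.
- by move=> a rest w _ IH /= /andP[-> /IH].
- by move=> B rest u v _ IHu _ IHv /= /andP[_ /IHv]; rewrite all_cat IHu.
Qed.

Lemma verify_sound C : all bit C -> verify k (start G) (map enc_entry (rules G)) C ->
  pangram_cfg_yes (k, G).
Proof.
move=> HC; rewrite /verify; case Eb: blocks => [[C1 es1]|] //.
have [|E HE Hs] := blocks_sound _ HC Eb; first by left.
rewrite HE nt_strE; case Er: runF => [[C2 ws]|] // Hl.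
have [js [w [/(lderives_sound Hs) [w' H1 H2] Ews]]] := run_sound Er.
exists w'; split; first exact: derives_seq_NT1.
split; first by have [/(_ _ _ (derives_seq_NT1 H1))] := derives_wf.
move=> a Ha; have [e He|e /mapP [u Hu ->] /= Eu] := lookup_all_sound Hl _ Ha.
  case/mapP: He => u; rewrite Ews cats0 revK => /mapP[b _ ->] -> /=; exact: bits_bit.
by move: Hu; rewrite Ews cats0 revK Eu => /mapP[b Hb /bits_inj ->]; apply: H2.
Qed.

End Grammar.

(** * Short certificates *)

Definition code (j : nat) : seq nat := nseq j 1 ++ [:: 2].
Definition codes (js : seq nat) : seq nat := flatten (map code js).

Lemma codes_bit js : all bit (codes js).
Proof.
elim: js => //= j js IH; rewrite /codes /= all_cat IH andbT all_cat /= andbT.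
by elim: j.
Qed.

Lemma size_codes js X : all (fun j => j < X) js -> size (codes js) <= size js * X.
Proof.
elim: js => //= j js IH /andP[Hj /IH H]; rewrite /codes /= size_cat size_cat size_nseq mulSn /=.
by rewrite -/(codes js); lia.
Qed.

Lemma select_code es1 es2 dn D :
  select (code (size es1) ++ D) dn (es1 ++ es2) = Some (D, rev es1 ++ dn, es2).
Proof.
rewrite /code -catA /=; elim: es1 dn => //= e es1 IH dn.
by rewrite IH rev_cons cat_rcons.
Qed.

Lemma expand_code E1 r E2 D X :
  expand (map enc_entry (E1 ++ r :: E2)) (code (size E1) ++ D) (rcons (bits r.1) 3 ++ X)
  = Some (D, enc_rhs r.2 ++ X).
Proof.
rewrite /expand map_cat -(size_map enc_entry) select_code /=.
by rewrite take_size_cat ?drop_size_cat ?size_rcons ?eqxx.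
Qed.

Lemma run_complete E al js w D ws : lderives E al js w -> exists n0,
  run n0 (map enc_entry E) (codes js ++ D) (enc_rhs al) ws = Some (D, rev (map bits w) ++ ws).
Proof.
move=> H; elim: H ws => {al js w} [|a al js w _ IH|E1 r E2 al js w HE _ IH] ws.
- by exists 1.
- have [n0 H] := IH (bits a :: ws); exists n0.+1.
  rewrite enc_rhs_cons /enc_symb enc_natE cat_cons cat_rcons /= index3_bits mem_cat inE eqxx orbT.
  rewrite take_size_cat // -cat_rcons drop_size_cat ?size_rcons //.
  by rewrite H rev_cons cat_rcons.
- have [n0 H] := IH ws; exists n0.+1.
  rewrite enc_rhs_cons /enc_symb enc_natE cat_cons /= /codes /= -catA {1}HE expand_code.
  by rewrite -H /enc_rhs map_cat flatten_cat.
Qed.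

(** Allows a run to be built with whatever fuel is convenient and then transferred to the fuel fixed
    by the measure. *)
Lemma run_fuel n m es C W ws x : run n es C W ws = Some x ->
  size C * (size (flat es)).+1 + size W < m -> run m es C W ws = Some x.
Proof.
elim: n m C W ws => // n IH [|m] C W ws //.
case: W => [|[|[|[|[|a]]]] W] //=.
- case: ifP => // H3 H Hm; apply: IH H _; have := congr1 size (split_index3 H3).
  by rewrite size_cat /=; lia.
- case E: expand => [[C' W']|] // H Hm; apply: IH H _.
  have [[u [rhs [W2 [Hin EW EW']]]] HsC _] := expand_spec E.
  have := size_flat_mem Hin; move: Hm; rewrite EW EW' !size_cat /= => Hm Hs.
  set F := (size (flat es)).+1 in Hm Hs *.
  have : size C' * F + F <= size C * F by rewrite addnC -mulSn leq_mul2r HsC orbT.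
  by clear -Hm Hs; rewrite /F in Hm *; lia.
Qed.

Lemma runF_complete E al js w D : lderives E al js w ->
  runF (map enc_entry E) (codes js ++ D) (enc_rhs al) = Some (D, rev (map bits w)).
Proof.
case/(@run_complete _ _ _ _ D [::]) => n0 H; rewrite cats0 in H.
exact: run_fuel H (leqnn _).
Qed.

Definition codeB (u : seq nat) : seq nat := flatten [seq [:: 2; b] | b <- u] ++ [:: 1].

Lemma readB_code u D acc : readB (codeB u ++ D) acc = Some (rev u ++ acc, D).
Proof. by elim: u acc => //= b u IH acc; rewrite /codeB /= IH rev_cons cat_rcons. Qed.

Lemma codeB_bit u : all bit u -> all bit (codeB u).
Proof. by elim: u => //= b u IH /andP[Hb /IH H]; rewrite /codeB /= Hb. Qed.

Lemma size_codeB u : size (codeB u) = (2 * size u).+1.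
Proof. by elim: u => //= b u IH; move: IH; rewrite /codeB /= => ->; lia. Qed.

Definition block_code (b : nat) (js : seq nat) : seq nat := 2 :: codeB (bits b) ++ codes js.

Lemma blocks_step n E b js w D : lderives E [:: NT b] js w ->
  blocks n.+1 (map enc_entry E) (block_code b js ++ D)
  = blocks n (map enc_entry ((b, [::]) :: E)) D.
Proof.
move=> H; rewrite /block_code cat_cons -catA /= readB_code cats0 revK nt_strE.
by rewrite (runF_complete _ H).
Qed.

Definition letter_rules (w : seq nat) : seq crule := [seq (a, [::]) | a <- w].

Lemma lookup_complete j (w : seq nat) : (forall a, a < j -> a \in w) ->
  exists C, [/\ all bit C, size C <= j * size w &
    lookup_all (map enc_entry (letter_rules w)) j C].
Proof.
elim: j => [|j IH] Hw; first by exists [::].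
have [|C [H1 H2 H3]] := IH; first by move=> a Ha; apply: Hw; lia.
have Hj := Hw j (ltnSn j); have Hi : index j w < size w by rewrite index_mem.
exists (code (index j w) ++ C); split.
- by rewrite all_cat H1 andbT -[code _]cats0; apply: (codes_bit [:: _]).
- by rewrite /code !size_cat size_nseq mulSn /=; lia.
- have Ew : letter_rules w = take (index j w) (letter_rules w) ++ (j, [::]) :: drop (index j w).+1 (letter_rules w).
    rewrite -{1}(cat_take_drop (index j w) (letter_rules w)) (drop_nth (0, [::])) ?size_map //.
    by rewrite (nth_map 0) // nth_index.
  have := @expand_code (take (index j w) (letter_rules w)) (j, [::]) (drop (index j w).+1 (letter_rules w)) C [::].
  by rewrite -Ew size_takel ?size_map 1?ltnW // cats0 /= => ->.
Qed.

(** * Productive nonterminals and saturation *)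

Definition ntin (c : nat) (al : seq symb) : bool :=
  has (fun s => if s is NT d then d == c else false) al.
Definition all_nt (P : pred nat) (al : seq symb) : bool :=
  all (fun s => if s is NT d then P d else true) al.

Lemma all_ntP (P : pred nat) al : reflect (forall c, ntin c al -> P c) (all_nt P al).
Proof.
elim: al => [|[a|b] al IH] /=; first by constructor.
- exact: IH.
- apply: (iffP andP) => [[Hb /IH H] c /orP[/eqP <-|/H] //|H].
  by split; [apply: H; rewrite eqxx | apply/IH => c Hc; apply: H; rewrite Hc orbT].
Qed.

Lemma derives_seq_nt G al w c : derives_seq G al w -> ntin c al -> productive G c.
Proof.
elim=> //= B rest u v HB _ IH /orP[/eqP <-|] //; by exists u.
Qed.

Section Completeness.
Variables (k : nat) (G : cfg).
Hypothesis wfG : wf_cfg k G.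

Definition ext_rules (P : seq nat) : seq crule := letter_rules P ++ rules G.

Lemma ld_eps P c al js w : c \in P -> lderives (ext_rules P) al js w ->
  exists j, lderives (ext_rules P) (NT c :: al) (j :: js) w.
Proof.
move=> Hc H; have [P1 [P2 EP]] : exists P1 P2, P = P1 ++ c :: P2.
  by case/splitPr: Hc => P1 P2; exists P1, P2.
exists (size (letter_rules P1)).
apply: (@ld_NT _ _ (c, [::]) (letter_rules P2 ++ rules G)) => //.
by rewrite {1}EP /ext_rules /letter_rules map_cat /= -catA.
Qed.

Lemma ld_rule P r al js w : List.In r (rules G) -> lderives (ext_rules P) (r.2 ++ al) js w ->
  exists j, lderives (ext_rules P) (NT r.1 :: al) (j :: js) w.
Proof.
move=> Hr H; have [s1 [s2 Es]] := In_split_cat Hr; exists (size (letter_rules P ++ s1)).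
by apply: ld_NT H; rewrite /ext_rules Es catA.
Qed.

Lemma ld_all_eps (P : seq nat) al : all_nt (mem P) al ->
  exists js w, lderives (ext_rules P) al js w /\ size js <= size al.
Proof.
elim: al => [|[a|c] al IH] /=; first by exists [::], [::]; split=> //; apply: ld_nil.
  by case/IH=> js [w [H Hs]]; exists js, (a :: w); split; [apply: ld_T | lia].
case/andP=> Hc /IH [js [w [H Hs]]]; have [j Hj] := ld_eps Hc H.
by exists (j :: js), w; split.
Qed.

(** Without an applicable rule [P] is closed under the rules, so by induction on derivations it
    contains every productive nonterminal: saturation may stop. *)
Lemma not_productive_step (P : seq nat) (Q := fun r : crule => (r.1 \notin P) && all_nt (mem P) r.2) :
  ~~ has Q (rules G) ->
  (forall A w, derives G A w -> A \in P) /\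
  (forall al w, derives_seq G al w -> all_nt (mem P) al).
Proof.
move=> Hn; apply: derives_both => //=.
- move=> A rhs w Hr _ Ha; apply: contraNT Hn => HA.
  have : forall s, List.In (A, rhs) s -> has Q s.
    elim=> //= r s IH [->|/IH ->]; last by rewrite orbT.
    by rewrite /Q /= HA Ha.
  exact.
- by move=> B rest u v _ -> _ ->.
Qed.

Lemma has_In (U : Type) (Q : pred U) s : has Q s -> exists2 r, List.In r s & Q r.
Proof.
elim: s => //= r s IH /orP[Hr|/IH [r' H1 H2]]; first by exists r => //; left.
by exists r' => //; right.
Qed.

Lemma size_rules_le : size (rules G) + nnt G <= cfg_size G.
Proof. by rewrite /cfg_size addnC leq_add2l; elim: (rules G) => //= r s; lia. Qed.

Lemma size_rhs_le r : List.In r (rules G) -> size r.2 <= cfg_size G.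
Proof.
move=> Hr; apply: leq_trans (leq_addl _ _).
by elim: (rules G) Hr => //= r' s IH [->|/IH]; lia.
Qed.

Let N := cfg_size G.

Definition good_set (P : seq nat) : Prop :=
  [/\ uniq P, all (fun b => b < nnt G) P & forall b, b \in P -> productive G b].

Lemma good_set_size P : good_set P -> size P <= nnt G.
Proof.
case=> Hu Ha _; rewrite -(size_iota 0 (nnt G)); apply: uniq_leq_size => // b /(allP Ha).
by rewrite mem_iota.
Qed.

Lemma ext_rules_size P : good_set P -> size (ext_rules P) <= N.
Proof.
by move/good_set_size=> H; rewrite size_cat size_map; have := size_rules_le; rewrite -/N; lia.
Qed.

Lemma ext_rules_sound P : good_set P -> forall r, List.In r (ext_rules P) -> sound_rule G r.
Proof.
case=> _ _ HP r /(@List.in_app_or _ _ _ _) [|H]; last by left.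
elim: P HP => //= b P IH HP [<-|]; first by right; split=> //; apply: HP; rewrite mem_head.
by apply: IH => c Hc; apply: HP; rewrite inE Hc orbT.
Qed.

(** One step applies the rule found, and at most one further step per symbol erases its right
    side. *)
Lemma good_set_grow P : good_set P ->
  has (fun r : crule => (r.1 \notin P) && all_nt (mem P) r.2) (rules G) ->
  exists b js w, [/\ lderives (ext_rules P) [:: NT b] js w, good_set (b :: P),
    size js <= N.+1 & b <= N].
Proof.
move=> HP Eh; have [[b rhs] Hr /andP[/= Hb Ha]] := has_In Eh.
have [js [w [Hjs Hsz]]] := ld_all_eps Ha.
have [|j Hj] := @ld_rule P _ [::] js w Hr; first by rewrite cats0.
have [w' Hw' _] := lderives_sound (ext_rules_sound HP) Hj.
have HbG : b < nnt G := (wfG.2 _ _ Hr).1.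
exists b, (j :: js), w; split=> //.
- have [Hu Hal Hp] := HP; split; first by rewrite /= Hb.
    by rewrite /= Hal HbG.
  by move=> c; rewrite inE => /orP[/eqP ->|/Hp //]; exists w'; apply: derives_seq_NT1.
- by have := size_rhs_le Hr; rewrite -/N /=; lia.
- by have := size_rules_le; rewrite -/N; lia.
Qed.

(** [m] bounds how many nonterminals are still missing. A block has at most [2 * N + 2] symbols for
    the name and [N.+1] positions below [N], together less than [(N + 2) ^ 2]. *)
Lemma saturate m P : good_set P -> nnt G <= m + size P ->
  exists P' C, [/\ good_set P', forall b, productive G b -> b \in P', all bit C,
    size C <= m * (N + 2) ^ 2 &
    forall n D, size C < n ->
      blocks n (map enc_entry (ext_rules P)) (C ++ 1 :: D)
      = Some (D, map enc_entry (ext_rules P'))].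
Proof.
elim: m P => [|m IH] P HP Hm.
all: case Eh: (has (fun r : crule => (r.1 \notin P) && all_nt (mem P) r.2) (rules G)).
- have [b [js [w [_ /good_set_size HP' _ _]]]] := good_set_grow HP Eh.
  by rewrite /= in HP'; lia.
- exists P, [::]; split=> //; last by case.
  by move=> b [w Hw]; apply: (not_productive_step (negbT Eh)).1 Hw.
- have [b [js [w [Hj HP' Hjs HbN]]]] := good_set_grow HP Eh.
  have [|P' [C [H1 H2 H3 H4 H5]]] := IH _ HP'; first by rewrite /=; lia.
  exists P', (block_code b js ++ C); split=> //.
  + by rewrite all_cat H3 andbT /= all_cat codeB_bit ?bits_bit //; apply: codes_bit.
  + have Hl : size (codes js) <= size js * N.
      apply: size_codes; apply: sub_all (lderives_lt Hj) => i Hi.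
      exact: leq_trans Hi (ext_rules_size HP).
    have Hbs := size_bits b.
    rewrite size_cat /block_code /= size_cat size_codeB mulSn.
    have : size js * N <= N.+1 * N by rewrite leq_mul2r Hjs orbT.
    have : (N + 2) ^ 2 = N * N + 4 * N + 4 by rewrite expnS expn1; nia.
    by lia.
  + case=> // n D; rewrite size_cat => Hn.
    rewrite -catA (blocks_step _ _ Hj) -[(b, [::]) :: _]/(ext_rules (b :: P)) H5 //.
    by move: Hn; rewrite /=; lia.
- exists P, [::]; split=> //; last by case.
  by move=> b [w Hw]; apply: (not_productive_step (negbT Eh)).1 Hw.
Qed.

(** * Short derivations covering a set of letters *)

Variable P : seq nat.
Hypothesis fullP : forall b, productive G b -> b \in P.

(** A step down a pruned tree without branching: [c] is kept and its siblings can be erased. Being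
    boolean, the relation can be used with [path], and [shortenP] removes repeated nonterminals. *)
Definition edge (b c : nat) : bool :=
  has (fun r : crule => [&& r.1 == b, ntin c r.2 & all_nt (mem P) r.2]) (rules G).

Lemma all_nt_split c al : ntin c al -> exists al1 al2, al = al1 ++ NT c :: al2.
Proof.
elim: al => //= s al IH /orP[|/IH [a1 [a2 ->]]]; last by exists (s :: a1), a2.
by case: s => // d /eqP ->; exists [::], al.
Qed.

Lemma ld_edge b c js w : edge b c -> lderives (ext_rules P) [:: NT c] js w ->
  exists js' w', [/\ lderives (ext_rules P) [:: NT b] js' w', {subset w <= w'} &
    size js' <= size js + N.+1].
Proof.
move=> Hbc H; have [r Hr /and3P[/eqP <- Hc Ha]] := has_In Hbc; have Hs := size_rhs_le Hr.
have [a1 [a2 Er]] := all_nt_split Hc.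
move: Ha Hs; rewrite {1 2}Er /all_nt all_cat size_cat /= => /and3P[Ha1 _ Ha2] Hs.
have [j1 [w1 [H1 S1]]] := ld_all_eps Ha1; have [j2 [w2 [H2 S2]]] := ld_all_eps Ha2.
have H3 := lderives_cat H1 (lderives_cat H H2).
have [j Hj] : exists j, lderives (ext_rules P) [:: NT r.1] (j :: j1 ++ js ++ j2) (w1 ++ w ++ w2).
  by apply: (ld_rule Hr); rewrite cats0 Er.
exists (j :: j1 ++ js ++ j2), (w1 ++ w ++ w2); split=> //.
  by move=> x Hx; rewrite !mem_cat Hx orbT.
by rewrite /= !size_cat; rewrite -/N in Hs; lia.
Qed.

Lemma edge_lt b c : edge b c -> c < nnt G.
Proof.
move=> Hbc; have [[a rhs] Hr /and3P[_ + _]] := has_In Hbc; have [_ +] := wfG.2 _ _ Hr.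
elim: rhs {Hr} => //= s rhs IH /andP[Hs /IH H] /orP[|/H] //.
by case: s Hs => // d Hd /eqP <-.
Qed.

Lemma ld_path b p js w : path edge b p -> lderives (ext_rules P) [:: NT (last b p)] js w ->
  exists js' w', [/\ lderives (ext_rules P) [:: NT b] js' w', {subset w <= w'} &
    size js' <= size js + size p * N.+1].
Proof.
elim: p b => [|c p IH] b /=; first by move=> _ H; exists js, w; split=> //; lia.
case/andP=> Hbc /IH H /H [js1 [w1 [H1 S1 L1]]].
have [js2 [w2 [H2 S2 L2]]] := ld_edge Hbc H1.
by exists js2, w2; split=> //; [move=> x /S1/S2 | rewrite mulSn; lia].
Qed.

Lemma ld_short_path b p js w : path edge b p -> lderives (ext_rules P) [:: NT (last b p)] js w ->
  exists js' w', [/\ lderives (ext_rules P) [:: NT b] js' w', {subset w <= w'} &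
    size js' <= size js + N * N.+1].
Proof.
case/shortenP=> p' Hp' Hu _ H.
have [js' [w' [H1 H2 H3]]] := ld_path Hp' H; exists js', w'; split=> //.
have : size p' <= N.
  have Hn : size p' <= nnt G.
    rewrite -(size_iota 0 (nnt G)); apply: uniq_leq_size; first by case/andP: Hu.
    move=> x; rewrite mem_iota /=; elim: p' b Hp' {Hu H H1 H3} => //= c p' IH b /andP[Hc Hp].
    by rewrite inE => /orP[/eqP ->|/(IH _ Hp)] //; apply: edge_lt Hc.
  by have := size_rules_le; rewrite -/N; lia.
by move=> Hp; apply: leq_trans H3 _; rewrite leq_add2l leq_mul2r Hp orbT.
Qed.

(** The cost of a branching node: [N.+1] for its rule and the symbols on the right side, and
    [N * N.+1] for the chain leading to it. *)
Let D := N.+1 * N.+1.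

Definition covered (b : nat) (ls : seq nat) (s : nat) : Prop :=
  exists js w, [/\ lderives (ext_rules P) [:: NT b] js w, {subset ls <= w} & size js <= s].

Section Split.
Variable l : nat.
Hypothesis IHl : forall b w (ls : seq nat), derives G b w -> uniq ls -> {subset ls <= w} ->
  0 < size ls < l -> covered b ls (D * size ls ^ 2).

(* [b] reaches a nonterminal whose rule distributes [ls] over several symbols. *)
Definition splits (b : nat) (ls : seq nat) : Prop :=
  exists2 p, path edge b p & covered (last b p) ls (N.+1 + D * l.-1 * l).

(** As long as one symbol derives all [l] letters, the path is extended by an edge. At the first
    node where none does, every symbol receives fewer than [l] letters and [IHl] applies. There
    [l_i ^ 2 <= (l - 1) * l_i] makes the bound linear in the number of letters, so that it adds up
    along the right side. *)
Lemma split_step :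
  (forall b w, derives G b w -> forall ls : seq nat, uniq ls -> {subset ls <= w} -> size ls = l ->
     0 < l -> splits b ls) /\
  (forall al w, derives_seq G al w -> forall ls : seq nat, uniq ls -> {subset ls <= w} -> size ls <= l ->
     0 < l ->
     (size ls = l /\ exists2 c, ntin c al & splits c ls) \/
     (exists js v, [/\ lderives (ext_rules P) al js v, {subset ls <= v} &
        size js <= size al + D * l.-1 * size ls])).
Proof.
apply: derives_both.
- move=> b rhs w Hr Hd IH ls Hu Hs Hl H0.
  have Ha : all_nt (mem P) rhs.
    by apply/all_ntP => c Hc; apply/fullP; apply: derives_seq_nt Hd Hc.
  have [|[_ [c Hc [p Hp Hcov]]]|[js [v [H1 H2 H3]]]] := IH ls Hu Hs _ H0; first by rewrite Hl.
    exists (c :: p) => //=; rewrite Hp andbT.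
    have : forall s, List.In (b, rhs) s ->
        has (fun r : crule => [&& r.1 == b, ntin c r.2 & all_nt (mem P) r.2]) s.
      by elim=> //= r s IHs [->|/IHs ->]; rewrite ?orbT //= eqxx Hc Ha.
    exact.
  exists [::] => //; have [|j Hj] := @ld_rule P _ [::] js v Hr; first by rewrite cats0.
  exists (j :: js), v; split=> //=; have := size_rhs_le Hr; rewrite -/N /= => Hn.
  by rewrite Hl in H3; lia.
- move=> ls Hu Hs _ _; right; exists [::], [::]; split=> //; exact: ld_nil.
- move=> a rest w _ IH ls Hu Hs Hl H0.
  pose ls' : seq nat := [seq x <- ls | x != a].
  have Hl' : size ls' <= size ls by rewrite size_filter count_size.
  have [|x||[Hll [c Hc Hsp]]|[js [v [H1 H2 H3]]]] := IH ls' _ _ _ H0.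
  + exact: filter_uniq.
  + by rewrite mem_filter => /andP[/negbTE Hx /Hs]; rewrite inE Hx.
  + exact: leq_trans Hl' Hl.
  + left; have El : size ls = l by lia.
    split=> //; exists c => //; suff -> : ls = ls' by [].
    by apply/esym/all_filterP; rewrite all_count -size_filter -/ls' Hll El.
  + right; exists js, (a :: v); split; [exact: ld_T | |].
      move=> x Hx; rewrite inE; case: eqVneq => //= Hxa; apply: H2.
      by rewrite mem_filter Hxa.
    apply: leq_trans H3 _; rewrite /= addSn; apply: leqW; rewrite leq_add2l leq_mul2l Hl' orbT //.
- move=> b rest u v Hu0 IHb _ IH ls Hu Hs Hl H0.
  (* A letter that occurs in several places is charged to the first symbol deriving it, so the
     groups are disjoint. *)
  pose l1 : seq nat := [seq x <- ls | x \in u]; pose l2 : seq nat := [seq x <- ls | x \notin u].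
  have Hc12 : size l1 + size l2 = size ls.
    by rewrite !size_filter -(count_predC (mem u)).
  have Hl1 : {subset l1 <= u} by move=> x; rewrite mem_filter => /andP[].
  have [E1|N1] := eqVneq (size l1) l.
    left; have El : size ls = l by lia.
    split=> //; exists b; rewrite /= ?eqxx //.
    suff -> : ls = l1 by apply: IHb => //; apply: filter_uniq.
    by apply/esym/all_filterP; rewrite all_count -size_filter -/l1 E1 El.
  have [|||[Hll [c Hc Hsp]]|[js [w [H1 H2 H3]]]] := IH l2 _ _ _ H0.
  + exact: filter_uniq.
  + by move=> x; rewrite mem_filter => /andP[Hx /Hs]; rewrite mem_cat (negbTE Hx).
  + lia.
  + left; have El : size ls = l by lia.
    split=> //; exists c; rewrite /= ?Hc ?orbT //; suff -> : ls = l2 by [].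
    by apply/esym/all_filterP; rewrite all_count -size_filter -/l2 Hll El.
  + right; have [js1 [w1 [H4 H5 H6]]] : covered b l1 (1 + D * l.-1 * size l1).
      (* A symbol charged with no letter is erased in one step, whence the summand 1. *)
      have [E0|P0] := posnP (size l1).
        have HbP : b \in P by apply: fullP; exists u.
        have [j Hj] := ld_eps HbP (ld_nil _); exists [:: j], [::]; split=> //.
        by move: E0 => /eqP; rewrite size_eq0 => /eqP ->.
      have [|js1 [w1 [H4 H5 H6]]] := @IHl b u l1 Hu0 (filter_uniq _ Hu) Hl1; first lia.
      exists js1, w1; split=> //; apply: leq_trans H6 _; rewrite expnS expn1 mulnA.
      apply: leqW; rewrite leq_mul2r leq_mul2l; apply/orP; right; apply/orP; right; lia.
    exists (js1 ++ js), (w1 ++ w); split; first exact: (@lderives_cat _ [:: NT b]).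
      move=> x Hx; rewrite mem_cat; case Hxu: (x \in u).
        by rewrite H5 // mem_filter Hxu.
      by rewrite (H2 x) ?orbT // mem_filter Hxu.
    by rewrite size_cat -Hc12 mulnDr /=; lia.
Qed.

End Split.

(* The bound is quadratic because distributing [l] letters over groups of sizes [l_i < l] costs
   [sum l_i ^ 2 <= (l - 1) * l], which leaves [l >= 1] for the chain above the branching node. *)
Lemma cover_letters b w (ls : seq nat) : derives G b w -> uniq ls -> {subset ls <= w} -> 0 < size ls ->
  covered b ls (D * size ls ^ 2).
Proof.
move: {2}(size ls) (leqnn (size ls)) => l; elim: l b w ls => [|l IH] b w ls Hl Hd Hu Hs H0.
  by lia.
have IHl : forall b w (ls' : seq nat), derives G b w -> uniq ls' -> {subset ls' <= w} ->
    0 < size ls' < size ls -> covered b ls' (D * size ls' ^ 2).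
  by move=> b' w' ls' Hd' Hu' Hs' /andP[H0' Hlt]; apply: IH Hd' Hu' Hs' H0'; lia.
have [p Hp [js [v [H1 H2 H3]]]] := (split_step IHl).1 _ _ Hd ls Hu Hs (erefl _) H0.
have [js' [v' [H4 H5 H6]]] := ld_short_path Hp H1.
exists js', v'; split=> //; first by move=> x /H2/H5.
apply: leq_trans H6 _.
case: (size ls) H0 H3 => // m _ /= H3.
have : D * m.+1 ^ 2 = D * m * m.+1 + D * m.+1 by rewrite expnS expn1; nia.
have : D <= D * m.+1 by rewrite mulnS; lia.
have : D = N.+1 + N * N.+1 by rewrite /D mulSn.
by lia.
Qed.

End Completeness.

(** * Polynomial bounds *)

Lemma ext_rules_rhs G P : all (fun r : crule => size r.2 <= cfg_size G) (ext_rules G P).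
Proof.
rewrite all_cat; apply/andP; split; first by elim: P.
have : forall r, List.In r (rules G) -> size r.2 <= cfg_size G by apply: size_rhs_le.
by elim: (rules G) => //= r s IH H; rewrite H ?IH //; [move=> r' Hr'; apply: H; right | left].
Qed.

Lemma verify_complete k G : wf_cfg k G -> pangram_cfg_yes (k, G) ->
  exists C, [/\ all bit C, size C <= (cfg_size G + k + 2) ^ 8 &
    verify k (start G) (map enc_entry (rules G)) C].
Proof.
move=> wfG [w [Hw [_ Hpan]]]; rewrite /in_lang /= in Hw.
have good0 : good_set G [::] by [].
have [|P [C1 [HP fullP HC1 L1 HB]]] := saturate wfG (m := nnt G) good0; first by rewrite addn0.
set X := cfg_size G + k + 2; set N := cfg_size G in L1.
(* [X ^ 4] comes from the covering bound: [N.+1 * N.+1 <= X ^ 2] and [k ^ 2 <= X ^ 2]. *)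
have [js [v [Hjs Hv Ljs]]] : covered G P (start G) (iota 0 k) (X ^ 4).
  have X0 : 0 < X by rewrite /X; lia.
  (* Covering needs at least one letter; over the empty alphabet the start symbol is simply
     erased. *)
  have [k0|k0] := posnP k.
    have HS : start G \in P by apply: fullP; exists w.
    have [j Hj] := ld_eps HS (ld_nil (ext_rules G P)).
    exists [:: j], [::]; rewrite k0; split=> //.
    by rewrite expn_gt0 X0.
  have [|||js [v [H1 H2 H3]]] := cover_letters wfG fullP Hw (ls := iota 0 k).
  - exact: iota_uniq.
  - by move=> a; rewrite mem_iota => /andP[_ Ha]; apply: Hpan.
  - by rewrite size_iota.
  exists js, v; split=> //; apply: leq_trans H3 _; rewrite size_iota -[4]/(2 + 2) expnD.
  apply: leq_mul; last by rewrite leq_exp2r // /X; lia.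
  by rewrite expnS expn1; apply: leq_mul; rewrite /X; lia.
have [|C3 [HC3 L3 Hl]] := @lookup_complete k v.
  by move=> a Ha; apply: Hv; rewrite mem_iota.
(* The productivity blocks, their end mark 1, the covering derivation, and the positions of the
   letters in its word. *)
exists (C1 ++ 1 :: codes js ++ C3); split.
- by rewrite all_cat HC1 /= all_cat codes_bit.
- have Lc : size (codes js) <= size js * N.
    apply: size_codes; apply: sub_all (lderives_lt Hjs) => i Hi.
    exact: leq_trans Hi (ext_rules_size HP).
  have := lderives_size (ext_rules_rhs G P) Hjs; rewrite -/N [size [:: _]]/= => Lv.
  have HX : N + 2 <= X by rewrite /X -/N; lia.
  have HkX : k + 2 <= X by rewrite /X; lia.
  have HnN : nnt G <= N by rewrite /N; have := @size_rules_le G; lia.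
  have HX3 : 3 <= X by rewrite /X /cfg_size; have [+ _] := wfG; lia.
  move: X HX HkX HX3 Ljs => X HX HkX HX3 Ljs.
  rewrite size_cat /= size_cat.
  have A1 : size C1 <= X ^ 7.
    apply: leq_trans L1 _; rewrite -[7]/(1 + (2 + 4)) !expnD expn1; apply: leq_mul; first lia.
    by rewrite -[X in X <= _]muln1; apply: leq_mul; rewrite ?leq_exp2r // expn_gt0; lia.
  have A2 : size js * N <= X ^ 5 by rewrite -[5]/(4 + 1) expnD expn1; apply: leq_mul => //; lia.
  have P5 : 0 < X ^ 5 by rewrite expn_gt0; lia.
  have A3 : size v <= X ^ 6 by rewrite expnS; nia.
  have A4 : size C3 <= k * X ^ 6 by apply: leq_trans L3 _; rewrite leq_mul2l A3 orbT.
  have A5 : k * X ^ 6 + 2 * X ^ 6 <= X ^ 7 by rewrite -mulnDl expnS leq_mul2r HkX orbT.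
  have A6 : X ^ 5 <= X ^ 6 by rewrite expnS; nia.
  have A7 : 3 * X ^ 7 <= X ^ 8 by rewrite [X ^ 8]expnS leq_mul2r HX3 orbT.
  by clear -A1 A2 A4 A5 A6 A7 Lc P5; lia.
- rewrite /verify -[map enc_entry (rules G)]/(map enc_entry (ext_rules G [::])) HB; last first.
    by rewrite size_cat; lia.
  rewrite nt_strE (runF_complete _ Hjs) (_ : final_entries _ = map enc_entry (letter_rules v)) //.
  by rewrite /final_entries revK /letter_rules -!map_comp; apply: eq_map.
Qed.

(** Well-formedness bounds all names by [k] or [nnt G], so even the crude [size (bits n) <= n] gives
    a quadratic bound: a symbol of a rule takes at most [2 * X] cells. *)
Lemma size_enc_inst k G : wf_cfg k G ->
  size (enc_inst (k, G)) <= 6 * (cfg_size G + k + 2) ^ 2.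
Proof.
move=> wfG; rewrite enc_instE; set X := cfg_size G + k + 2.
have Hk := size_bits k; have Hn := size_bits (nnt G); have Hs := size_bits (start G).
have Hr := size_bits (size (rules G)); have HrN := @size_rules_le G.
have HX : nnt G <= X by rewrite /X; lia.
have HkX : k <= X by rewrite /X; lia.
have Hst : start G < nnt G := wfG.1.
have Hrules : size (flatten (map enc_rule (rules G)))
    <= sumn (map (fun r => (size r.2).+1) (rules G)) * (2 * X).
  have : forall r, List.In r (rules G) ->
      [/\ r.1 <= X, size r.2 + 2 <= X & all (wf_symb k (nnt G)) r.2].
    move=> [A rhs] Hin; have [HA Hrhs] := wfG.2 _ _ Hin; split=> //=; first lia.
    by have := size_rhs_le Hin; rewrite /X /=; lia.
  elim: (rules G) => //= r s IH H.
  have {}IH := IH (fun r' Hr' => H r' (or_intror Hr')).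
  have [H1 H2 H3] := H r (or_introl (erefl _)).
  rewrite size_cat mulnDl; apply: leq_add IH; rewrite enc_ruleE !size_cat !size_rcons.
  have Hb1 := size_bits r.1; have Hb2 := size_bits (size r.2).
  have : size (enc_rhs r.2) <= size r.2 * (2 * X).
    elim: (r.2) H3 => //= s' rhs IHr /andP[Hw /IHr]; rewrite enc_rhs_cons size_cat mulSn.
    suff : size (enc_symb s') <= 2 * X by lia.
    by case: s' Hw => a /= Ha; rewrite enc_natE size_rcons; have := size_bits a; lia.
  by rewrite mulSn; lia.
rewrite !size_cat !size_rcons.
have HsX : sumn (map (fun r => (size r.2).+1) (rules G)) + 2 <= X by rewrite /X /cfg_size; lia.
have HrX : size (rules G) <= X by rewrite /X; lia.
move: (sumn _) HsX Hrules => S HsX Hrules.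
have : S * (2 * X) <= X * (2 * X) by apply: leq_mul; lia.
have : X * 2 <= X * X by apply: leq_mul; lia.
by rewrite expnS expn1; lia.
Qed.

Lemma poly_bound_exp d : exists c, forall n, 0 < n -> (n + 2) ^ d <= poly_bound c n.
Proof.
(* [n + 2 <= 3 * n] for positive [n], and [d <= 3 ^ d] lets the same constant serve as exponent. *)
exists (3 ^ d) => n Hn; rewrite /poly_bound; apply: leq_trans (leq_addr _ _).
apply: (@leq_trans (3 ^ d * n ^ d)); first by rewrite -expnMn; case: d => // d; rewrite leq_exp2r //; lia.
by rewrite leq_mul2l leq_pexp2l ?orbT // ltnW // ltn_expl.
Qed.

Lemma accepts_within_mono M x t u : t <= u -> accepts_within M t x -> accepts_within M u x.
Proof.
move=> Htu H; rewrite /accepts_within -(subnK Htu) iterD.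
by rewrite [iter (u - t) _ _]iter_halted ?H.
Qed.

Lemma enc_cert_bit cert : all bit (enc_cert cert).
Proof. by elim: cert => //= -[]. Qed.

Lemma enc_cert_surj C : all bit C -> exists2 cert, enc_cert cert = C & size cert = size C.
Proof.
elim: C => [|a C IH] /=; first by exists [::].
case/andP=> /orP[] /eqP -> /IH [cert <- H]; first by exists (false :: cert); rewrite /= ?H.
by exists (true :: cert); rewrite /= ?H.
Qed.

Lemma input_ok k G C : all bit C -> all (fun a => 0 < a < 5) (enc_inst (k, G) ++ 4 :: C).
Proof.
move=> HC; rewrite all_cat /=; apply/andP; split.
  by apply: sub_all (enc_inst_okay k G) => a /andP[].
by apply: sub_all HC => a /orP[] /eqP ->.
Qed.

(** The exponent 62 is that of the running time of the verifier; the simulation squares it, and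
    [X ^ 3 >= 27] absorbs the constants. *)
Lemma sim_bound X t s : 3 <= X -> t <= X ^ 62 -> s <= X ^ 62 ->
  t * (2 * (s + t) + 4) + 4 <= X ^ 127.
Proof.
move=> HX; rewrite -[127]/(3 + (62 + 62)) 2!expnD.
have : 0 < X ^ 62 by rewrite expn_gt0; lia.
have : 27 <= X ^ 3 by rewrite -[27]/(3 ^ 3) leq_exp2r.
move: (X ^ 62) (X ^ 3) => A B HB HA Ht Hs.
have : t * (2 * (s + t) + 4) <= A * (8 * A) by apply: leq_mul; lia.
have : 1 <= A * A by rewrite muln_gt0 HA.
have : 27 * (A * A) <= B * (A * A) by rewrite leq_mul2r HB orbT.
by lia.
Qed.

Lemma accepts_complete k G : wf_cfg k G -> pangram_cfg_yes (k, G) ->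
  exists2 cert, size cert <= (cfg_size G + k + 2) ^ 8 &
    accepts_within (machine (program MAIN)) ((cfg_size G + k + 2) ^ 127)
      (enc_inst (k, G) ++ 4 :: enc_cert cert).
Proof.
move=> wfG Hyes.
have [C [HC LC Hver]] := verify_complete wfG Hyes.
have [cert Ecert Lcert] := enc_cert_surj HC.
exists cert; first by rewrite Lcert.
have Le := size_enc_inst wfG.
have HsG : start G + size (rules G) + k + 3 <= 2 * (cfg_size G + k + 2).
  by have [+ _] := wfG; have := @size_rules_le G; clear; lia.
have HX3 : 3 <= cfg_size G + k + 2 by rewrite /cfg_size; have [+ _] := wfG; clear; lia.
move: (cfg_size G + k + 2) LC Le HsG HX3 => X LC Le HsG HX3.
have M a b : a <= b -> X ^ a <= X ^ b by move=> ?; rewrite leq_pexp2l // ltnW // ltnW.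
have X2 : 6 * X ^ 2 <= X ^ 4.
  rewrite -[4]/(2 + 2) expnD leq_mul2r; apply/orP; right; rewrite expnS expn1.
  by apply: leq_trans (leq_mul HX3 HX3).
have X4 := M 4 8 isT; have X1 : X <= X ^ 8 by rewrite -{1}(expn1 X); apply: M.
have X10 : 9 * X ^ 8 <= X ^ 10.
  by rewrite -[10]/(2 + 8) expnD leq_mul2r -[9]/(3 ^ 2) leq_exp2r ?HX3 ?orbT.
have HZ : size (enc_inst (k, G)) + size C + size (rules G) + k + start G <= X ^ 10.
  by move: (X ^ 2) (X ^ 4) (X ^ 8) (X ^ 10) X2 X4 X1 X10 LC Le; clear -HsG HX3; lia.
have [o [t Lt Hev] Ho] := main_ok HC HZ; rewrite Hver in Ho.
have [m Em] := Ho; rewrite {}Em in Hev.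
have := machine_correct (input_ok k G HC) Hev; rewrite Ecert; apply: accepts_within_mono.
apply: sim_bound => //.
  (* In [1000 * (Z + 2) ^ 5] with [Z = X ^ 10], the factor 1000 is below [3 ^ 7 <= X ^ 7], and
     [Z + 2 <= X ^ 11]. *)
  apply: leq_trans Lt _; rewrite -[62]/(7 + 11 * 5) expnD expnM; apply: leq_mul.
    by apply: (@leq_trans (3 ^ 7)) => //; rewrite leq_exp2r.
  rewrite leq_exp2r // [X ^ 11]expnS.
  have : 0 < X ^ 10 by rewrite expn_gt0 (ltnW (ltnW HX3)).
  by move: (X ^ 10) => Y HY; apply: leq_trans (leq_mul HX3 (leqnn Y)); clear -HY; lia.
apply: leq_trans (M 10 62 isT); rewrite size_cat [size (4 :: C)]/=.
by move: (X ^ 2) (X ^ 4) (X ^ 8) (X ^ 10) X2 X4 X1 X10 LC Le; clear -HX3; lia.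
Qed.

Theorem mainTheorem9 :
  in_NP enc_inst inst_size (fun i : nat * cfg => wf_cfg i.1 i.2) pangram_cfg_yes.
Proof.
have [c Hc] := poly_bound_exp 127.
exists (machine (program MAIN)), c => -[k G] /= wfG; rewrite /inst_size /=.
have Hn : 0 < cfg_size G + k by rewrite /cfg_size; have [+ _] := wfG; clear; lia.
have {Hc} Hp := Hc _ Hn.
split=> [Hyes|[cert [_ Hacc]]].
- have [cert L Hacc] := accepts_complete wfG Hyes; exists cert.
  split; last exact: accepts_within_mono Hp Hacc.
  by apply: leq_trans L (leq_trans _ Hp); rewrite leq_pexp2l // addn2.
- have HC := enc_cert_bit cert.
  (* Soundness holds for certificates of any length: [Z] is taken to be the actual sum of sizes, and
     a rejecting evaluation excludes acceptance at every time. *)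
  have [o [t _ Hev]] := main_ok HC (leqnn (size (enc_inst (k, G)) + size (enc_cert cert) +
    size (rules G) + k + start G)).
  case Hver: verify; first by move=> _; exact: (verify_sound wfG HC Hver).
  move=> Ho; rewrite Ho in Hev.
  by have /(_ _ Hacc) := machine_correct (input_ok k G HC) Hev.
Qed.
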